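(* Let $n\ge 1$, let $f:[0,1]^n\to\mathbb{R}$ be twice continuously differentiable in $(0,1)^n$, such that $f$ and all its first and second order derivatives extend continuously to the boundary. Let $p\in(0,1)$ and let $Y=(Y_1,\ldots,Y_n)$ be a vector of $n$ i.i.d. Bernoulli$(p)$ random variables. Let $a,b_i,c_{ij}$, $\mathcal{D}(\cdot)$ and $\phi_p$ be as defined in the context. Then for any $\delta>0$, $\epsilon>0$ and $t\in\mathbb{R}$, with $K:=\phi_p(t)/n$, $$\log \mathbb{P}(f(Y)\ge tn)\le -\phi_p(t-\delta)+\mathcal{T}_1+\mathcal{T}_2,$$ where the complexity term $\mathcal{T}_1$ and the smoothness term $\mathcal{T}_2$ are $$\mathcal{T}_1:=\frac14\Big(n\sum_{i=1}^n\beta_i^2\Big)^{1/2}\epsilon+3n\epsilon+\log\biggl(\frac{4K\bigl(\frac1n\sum_{i=1}^n b_i^2\bigr)^{1/2}}{\delta\epsilon}\biggr)+\log\bigl|\mathcal{D}\bigl((\delta\epsilon)/(4K)\bigr)\bigr|,$$ $$\mathcal{T}_2:=4\biggl(\sum_{i=1}^n(\alpha\gamma_{ii}+\beta_i^2)+\frac14\sum_{i,j=1}^n\bigl(\alpha\gamma_{ij}^2+\beta_i\beta_j\gamma_{ij}+4\beta_i\gamma_{ij}\bigr)\biggr)^{1/2}+\frac14\Big(\sum_{i=1}^n\beta_i^2\Big)^{1/2}\Big(\sum_{i=1}^n\gamma_{ii}^2\Big)^{1/2}+3\sum_{i=1}^n\gamma_{ii}+\log 2,$$ with $$\alpha:=nK+n|\log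 p|+n|\log(1-p)|,\qquad \beta_i:=\frac{2Kb_i}{\delta}+|\log p|+|\log(1-p)|,\qquad \gamma_{ij}:=\frac{2Kc_{ij}}{\delta}+\frac{6Kb_ib_j}{n\delta^2}.$$ Moreover, for any $t\in\mathbb{R}$, $$\log\mathbb{P}(f(Y)\ge tn)\ge -\phi_p(t+\delta_0)-\epsilon_0 n-\log 2,$$ where $$\epsilon_0:=\frac1{\sqrt n}\biggl(4+\biggl|\log\frac{p}{1-p}\biggr|\biggr),\qquad \delta_0:=\frac2n\biggl(\sum_{i=1}^n(ac_{ii}+b_i^2)\biggr)^{1/2}.$$
   Context: $\|g\|$ denotes the supremum norm of a function $g$ on $[0,1]^n$. For the given $f$, $f_i:=\partial f/\partial x_i$, $f_{ij}:=\partial^2 f/\partial x_i\partial x_j$, and $a:=\|f\|$, $b_i:=\|f_i\|$, $c_{ij}:=\|f_{ij}\|$. For each $\epsilon>0$, $\mathcal{D}(\epsilon)$ is a (fixed) finite subset of $\mathbb{R}^n$ such that for all $x\in\{0,1\}^n$ there exists $d=(d_1,\ldots,d_n)\in\mathcal{D}(\epsilon)$ with $\sum_{i=1}^n(f_i(x)-d_i)^2\le n\epsilon^2$. For $u\in[0,1]$, $I_p(u):=u\log\frac up+(1-u)\log\frac{1-u}{1-p}$ (with $0\log 0=0$), and for $x\in[0,1]^n$, $I_p(x):=\sum_{i=1}^nI_p(x_i)$. For $t\in\mathbb{R}$, $\phi_p(t):=\inf\{I_p(x):x\in[0,1]^n,\ f(x)\ge tn\}$.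
   Formalization: In T_1 the term log(4K((1/n)Σb_i²)^{1/2}/(δε)) is replaced by log max(1, 4K((1/n)Σb_i²)^{1/2}/(δε)), as the literal bound fails for large δ (n=1, f(x)=x, p=1/2, t=1, D={1}); if K=0 or φ_p(t)=+∞, where T_1 is undefined, K is taken as 0. *)

(* Defs.v *)
From HB Require Import structures.
From mathcomp Require Import all_boot all_order all_algebra finmap.
From mathcomp Require Import all_classical all_reals all_analysis.

Set Implicit Arguments.
Unset Strict Implicit.
Unset Printing Implicit Defensive.

Import Order.TTheory GRing.Theory Num.Theory.
Import numFieldNormedType.Exports.

Local Open Scope classical_set_scope.
Local Open Scope ring_scope.

Section cube.
Context {R : realType} {n : nat}.
Implicit Types (f : 'rV[R]_n -> R) (x : 'rV[R]_n).

Definition cube : set 'rV[R]_n := [set x | forall i, 0 <= x 0 i <= 1].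

Definition open_cube : set 'rV[R]_n := [set x | forall i, 0 < x 0 i < 1].

Definition partial (i : 'I_n) f : 'rV[R]_n -> R := 'D_(delta_mx 0 i) f.

(* [f1 i] and [f2 i j] are the continuous extensions to the closed cube of
   the partial derivatives of [f], which are only constrained inside the open
   cube; they are determined by [f] on the cube.  The values of [f], [f1] and
   [f2] outside the cube are irrelevant. *)
Definition C2_on_cube f (f1 : 'I_n -> 'rV[R]_n -> R)
    (f2 : 'I_n -> 'I_n -> 'rV[R]_n -> R) : Prop :=
  [/\ {within cube, continuous f},
      forall i, {within cube, continuous (f1 i)},
      forall i j, {within cube, continuous (f2 i j)},
      forall i x, open_cube x ->
        derivable f x (delta_mx 0 i) /\ partial i f x = f1 i x &
      forall i j x, open_cube x ->
        derivable (partial j f) x (delta_mx 0 i) /\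
        partial i (partial j f) x = f2 i j x].

Definition supnorm f : R := sup [set `|f x| | x in cube].

Definition gradient_net (f1 : 'I_n -> 'rV[R]_n -> R)
    (D : R -> {fset 'rV[R]_n}) : Prop :=
  forall eps : R, 0 < eps ->
  forall x, (forall i, x 0 i = 0 \/ x 0 i = 1) ->
  exists2 d, d \in D eps &
    \sum_(i < n) (f1 i x - d 0 i) ^+ 2 <= n%:R * eps ^+ 2.

End cube.

Section rate_function.
Context {R : realType}.

(* As [ln 0 = 0], this includes the convention 0 log 0 = 0. *)
Definition rel_entropy (p u : R) : R :=
  u * ln (u / p) + (1 - u) * ln ((1 - u) / (1 - p)).

Definition rel_entropy_vec n (p : R) (x : 'rV[R]_n) : R :=
  \sum_(i < n) rel_entropy p (x 0 i).

(* Equal to [+oo] when [f < t * n] on the whole cube. *)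
Definition phi n (p : R) (f : 'rV[R]_n -> R) (t : R) : \bar R :=
  ereal_inf [set (rel_entropy_vec p x)%:E |
             x in [set x | cube x /\ t * n%:R <= f x]].

End rate_function.

Section probability.
Local Open Scope ereal_scope.

Definition mutually_independent d d' (T : measurableType d)
    (T' : measurableType d') (R : realType) (P : probability T R)
    (I : finType) (Y : I -> {RV P >-> T'}) : Prop :=
  forall (J : {set I}) (A : I -> set T'), (forall i, measurable (A i)) ->
    P (\bigcap_(i in [set` J]) (Y i @^-1` A i)) =
    \prod_(i in J) P (Y i @^-1` A i).

Definition bool_vec (R : realType) n (y : 'I_n -> bool) : 'rV[R]_n :=
  \row_i (y i)%:R.

End probability.

Section bounds.
Context {R : realType} {n : nat}.
Variables (p K delta : R).
Variables (b : 'I_n -> R) (c : 'I_n -> 'I_n -> R).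

Definition alpha : R :=
  n%:R * K + n%:R * `|ln p| + n%:R * `|ln (1 - p)|.

Definition beta (i : 'I_n) : R :=
  2 * K * b i / delta + `|ln p| + `|ln (1 - p)|.

Definition gamma (i j : 'I_n) : R :=
  2 * K * c i j / delta + 6 * K * b i * b j / (n%:R * delta ^+ 2).

(* The argument of the third summand's logarithm bounds the number of points
   of a net of an interval, whence the maximum with 1, which has no effect as
   soon as [delta * eps <= 4 K (sum_i b_i^2 / n)^(1/2)].  Without it the upper
   tail bound is false: for [n = 1], [f x = x], [p = 1/2], [t = 1] and
   [D eps = {1}], the sum of the two terms tends to [-oo] as [delta] tends to
   [+oo], while [phi p f (t - delta)] is nonnegative and the probability is
   1/2.  When [K = 0], [D] is evaluated at 0, where it is unconstrained; this
   is harmless since the logarithm of a cardinal is nonnegative ([ln 0 = 0]). *)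
Definition complexity_term (D : R -> {fset 'rV[R]_n}) (eps : R) : R :=
  4^-1 * Num.sqrt (n%:R * \sum_(i < n) beta i ^+ 2) * eps
  + 3 * n%:R * eps
  + ln (Num.max 1 (4 * K * Num.sqrt (n%:R^-1 * \sum_(i < n) b i ^+ 2)
                   / (delta * eps)))
  + ln (#|` D (delta * eps / (4 * K))|%:R).

Definition smoothness_term : R :=
  4 * Num.sqrt (\sum_(i < n) (alpha * gamma i i + beta i ^+ 2)
       + 4^-1 * \sum_(i < n) \sum_(j < n)
           (alpha * gamma i j ^+ 2 + beta i * beta j * gamma i j
            + 4 * beta i * gamma i j))
  + 4^-1 * Num.sqrt (\sum_(i < n) beta i ^+ 2)
         * Num.sqrt (\sum_(i < n) gamma i i ^+ 2)
  + 3 * \sum_(i < n) gamma i i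
  + ln 2.

End bounds.

(* Main.v *)
(* Upper tail: with [g = psi o f], where [psi] vanishes on [t n, +oo[, equals
   [- n K] on ]-oo, (t - delta) n] and is [C^1] with Lipschitz derivative, the
   probability is at most [Z = E (exp (g Y))].  Let [X] have density
   proportional to [exp g] with respect to the law of [Y], and let [X^] be the
   vector of the conditional means of each coordinate given the others.  An
   exchangeable-pair computation shows that [g X - g X^] and the centred
   log-likelihood ratio have small second moments, so on an event of
   [X]-probability at least 3/4 the weight of [x] is at most
   [exp (sup (g - I_p) + error)] times the mass given to [x] by the Bernoulli
   product with means [x^].  That product depends on [x] only through the
   discrete gradient of [g], which is replaced by a point of a finite net; for
   each point of the net the masses sum to 1.
   Lower tail: change the measure to the Bernoulli product with means [y],
   where [y] is feasible for [t + delta0], and apply Chebyshev's inequality to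
   [f] and to the log-likelihood ratio. *)

Require Import Defs.
From HB Require Import structures.
From mathcomp Require Import all_boot all_order all_algebra finmap.
From mathcomp Require Import all_classical all_reals all_analysis.
From mathcomp Require Import ring lra.

Set Implicit Arguments.
Unset Strict Implicit.
Unset Printing Implicit Defensive.

Import Order.TTheory GRing.Theory Num.Theory.
Import numFieldNormedType.Exports.

Local Open Scope classical_set_scope.
Local Open Scope ring_scope.

(** * Functions with Lipschitz gradient on the cube *)

Section coordinates.
Context {R : realType} {n : nat}.
Implicit Types (x y : 'rV[R]_n) (i j : 'I_n) (s r : R).

Definition upd x i s : 'rV[R]_n := \row_j (if j == i then s else x 0 j).

(** As [k] runs from 0 to [n] this is a path from [y] to [x] that changes one coordinate at a time,
    so that differences telescope into one-variable increments. *)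
Definition hybrid x y (k : nat) : 'rV[R]_n :=
  \row_j (if (j < k)%N then x 0 j else y 0 j).

Lemma updE x i s j : upd x i s 0 j = if j == i then s else x 0 j.
Proof. by rewrite mxE. Qed.

Lemma upd_id x i : upd x i (x 0 i) = x.
Proof. by apply/rowP => j; rewrite updE; case: eqP => [->|]. Qed.

Lemma upd_upd x i s r : upd (upd x i s) i r = upd x i r.
Proof. by apply/rowP => j; rewrite !updE; case: eqP. Qed.

Lemma updC x i j s r : i != j -> upd (upd x i s) j r = upd (upd x j r) i s.
Proof.
by move=> ij; apply/rowP => k; rewrite !updE; case: eqP => // ->;
  rewrite eq_sym (negbTE ij).
Qed.

Lemma cube_upd x i s : cube x -> 0 <= s <= 1 -> cube (upd x i s).
Proof. by move=> cx s01 j; rewrite updE; case: eqP. Qed.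

Lemma hybrid0 x y : hybrid x y 0 = y.
Proof. by apply/rowP => j; rewrite mxE. Qed.

Lemma hybrid_full x y : hybrid x y n = x.
Proof. by apply/rowP => j; rewrite mxE ltn_ord. Qed.

Lemma hybridS x y i : hybrid x y i.+1 = upd (hybrid x y i) i (x 0 i).
Proof.
apply/rowP => j; rewrite updE !mxE ltnS leq_eqVlt.
by have [->|ij] := eqVneq j i; rewrite ?eqxx//= (negbTE (ij : j != i :> nat)).
Qed.

Lemma hybrid_upd x y i : hybrid x y i = upd (hybrid x y i) i (y 0 i).
Proof.
by apply/rowP => j; rewrite updE !mxE; case: eqP => // ->; rewrite ltnn.
Qed.

Lemma cube_hybrid x y k : cube x -> cube y -> cube (hybrid x y k).
Proof. by move=> cx cy j; rewrite mxE; case: ifP. Qed.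

Lemma telescope_hybrid (F : 'rV[R]_n -> R) x y :
  F x - F y = \sum_(i < n) (F (hybrid x y i.+1) - F (hybrid x y i)).
Proof.
rewrite -[X in F X - _](hybrid_full x y) -[X in _ - F X](hybrid0 x y).
by rewrite -(telescope_sumr (fun k => F (hybrid x y k)))// big_mkord.
Qed.

Lemma coordinatewise_lipschitz (F : 'rV[R]_n -> R) (L : 'I_n -> R) :
  (forall x i s, cube x -> 0 <= s <= 1 ->
     `|F (upd x i s) - F x| <= L i * `|s - x 0 i|) ->
  forall x y, cube x -> cube y ->
    `|F x - F y| <= \sum_i L i * `|x 0 i - y 0 i|.
Proof.
move=> FL x y cx cy; rewrite telescope_hybrid.
apply: (le_trans (ler_norm_sum _ _ _)); apply: ler_sum => i _.
rewrite hybridS; apply: (le_trans (FL _ _ _ _ (cx i))).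
  exact: cube_hybrid.
by rewrite mxE ltnn.
Qed.

End coordinates.

Section C11.
Context {R : realType} {n : nat}.
Implicit Types (x y : 'rV[R]_n) (i j : 'I_n) (s r : R).

(* [g1] is the gradient of [g], [b] bounds it, and [c i j] is a Lipschitz
   constant of [g1 j] in the direction of the [i]-th coordinate. *)
Record C11_on_cube (g : 'rV[R]_n -> R) (g1 : 'I_n -> 'rV[R]_n -> R)
    (b : 'I_n -> R) (c : 'I_n -> 'I_n -> R) : Prop := {
  C11_derive : forall x i r, cube x -> 0 < r < 1 ->
    is_derive r (1 : R) (fun s => g (upd x i s)) (g1 i (upd x i r));
  C11_continuous : forall x i, cube x ->
    {within `[0, 1], continuous (fun s => g (upd x i s))};
  C11_bound : forall x i, cube x -> `|g1 i x| <= b i;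
  C11_lipschitz : forall x i j s, cube x -> 0 <= s <= 1 ->
    `|g1 j (upd x i s) - g1 j x| <= c i j * `|s - x 0 i|;
  C11_c_ge0 : forall i j, 0 <= c i j }.

Context {g : 'rV[R]_n -> R} {g1 : 'I_n -> 'rV[R]_n -> R}
  {b : 'I_n -> R} {c : 'I_n -> 'I_n -> R}.
Hypothesis gC11 : C11_on_cube g g1 b c.

Lemma cube0 : cube (0 : 'rV[R]_n).
Proof. by move=> i; rewrite mxE lexx ler01. Qed.

Lemma C11_b_ge0 i : 0 <= b i.
Proof. by have := C11_bound gC11 i cube0; apply: le_trans. Qed.

Lemma C11_MVT x i s r : cube x -> 0 <= s <= 1 -> 0 <= r <= 1 ->
  exists2 t, 0 <= t <= 1 &
    g (upd x i s) - g (upd x i r) = (s - r) * g1 i (upd x i t).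
Proof.
move=> cx; wlog rs : s r / r <= s.
  move=> H s01 r01; have [rs|/ltW sr] := leP r s; first exact: H.
  have [t t01 E] := H _ _ sr r01 s01; exists t => //.
  by rewrite -opprB E -mulNr opprB.
move=> /andP[s0 s1] /andP[r0 r1].
have [||t] := @MVT_segment _ (fun s => g (upd x i s))
    (fun s => g1 i (upd x i s)) _ _ rs.
- move=> u; rewrite in_itv/= => /andP[ru us].
  apply: (C11_derive gC11) => //.
  by rewrite (le_lt_trans r0 ru) (lt_le_trans us).
- apply: (continuous_subspaceW _ (C11_continuous gC11 cx)).
  by apply: subset_itv; rewrite bnd_simp.
- rewrite in_itv/= => /andP[rt ts] E; exists t.
    by rewrite (le_trans r0) // (le_trans ts).
  by rewrite E mulrC.
Qed.

Lemma C11_value_lipschitz x y : cube x -> cube y ->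
  `|g x - g y| <= \sum_i b i * `|x 0 i - y 0 i|.
Proof.
apply: coordinatewise_lipschitz => {y}x i s cx s01.
rewrite -[in g x](upd_id x i); have [t t01 ->] := C11_MVT i cx s01 (cx i).
rewrite normrM mulrC ler_wpM2r//; apply: (C11_bound gC11).
exact: cube_upd.
Qed.

Lemma C11_gradient_lipschitz x y j : cube x -> cube y ->
  `|g1 j x - g1 j y| <= \sum_i c i j * `|x 0 i - y 0 i|.
Proof.
apply: coordinatewise_lipschitz => {y}x i s cx s01.
exact: (C11_lipschitz gC11).
Qed.

(** Mixed second derivatives need not exist. The mean value theorem is applied in direction [j] to
    the difference of the sections [x_i = 1] and [x_i = 0], whose derivative is an increment of
    [g1 j] in direction [i]. *)
Lemma C11_mixed_difference x i j : cube x -> i != j ->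
  `|(g (upd (upd x i 1) j 1) - g (upd (upd x i 1) j 0))
    - (g (upd (upd x i 0) j 1) - g (upd (upd x i 0) j 0))| <= c i j.
Proof.
move=> cx ij.
have c0 : cube (upd x i 0) by apply: cube_upd => //; rewrite lexx ler01.
have c1 : cube (upd x i 1) by apply: cube_upd => //; rewrite lexx ler01.
have [||t] := @MVT_segment _
    ((fun s => g (upd (upd x i 1) j s)) \- (fun s => g (upd (upd x i 0) j s)))
    (fun s => g1 j (upd (upd x i 1) j s) - g1 j (upd (upd x i 0) j s))
    _ _ ler01.
- move=> u; rewrite in_itv/= => u01.
  by apply: is_deriveB; apply: (C11_derive gC11).
- move=> u; apply: continuousB; exact: (C11_continuous gC11).
- rewrite in_itv/= subr0 mulr1 => t01 E.
  rewrite [X in `|X|](_ : _ = g1 j (upd (upd x i 1) j t)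
      - g1 j (upd (upd x i 0) j t)); last by rewrite -E; ring.
  have := C11_lipschitz gC11 (x := upd (upd x i 0) j t) i j (s := 1).
  rewrite ler01 lexx -(updC _ 1 t ij) upd_upd => H.
  apply: (le_trans (H _ isT)); first exact: cube_upd.
  by rewrite !updE (negbTE ij) eqxx subr0 normr1 mulr1.
Qed.

Lemma C11_weaken b' c' : (forall i, b i <= b' i) ->
  (forall i j, c i j <= c' i j) -> C11_on_cube g g1 b' c'.
Proof.
case: gC11 => H1 H2 H3 H4 H5 bb' cc'; split=> //.
- by move=> x i cx; apply: le_trans (bb' i); exact: H3.
- move=> x i j s cx s01; apply: (le_trans (H4 _ _ _ _ cx s01)).
  by rewrite ler_wpM2r.
- by move=> i j; apply: le_trans (cc' i j).
Qed.

End C11.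

(** * Second moments from conditional means *)

Section vertices.
Context {R : realType} {n : nat}.
Implicit Types (x : {ffun 'I_n -> bool}) (i j : 'I_n) (t : bool).

Definition vupd x i t : {ffun 'I_n -> bool} :=
  [ffun j => if j == i then t else x j].

Lemma vupdE x i t j : vupd x i t j = if j == i then t else x j.
Proof. by rewrite ffunE. Qed.

Lemma vupd_id x i : vupd x i (x i) = x.
Proof. by apply/ffunP => j; rewrite vupdE; case: eqP => [->|]. Qed.

Lemma bool_vecE x i : bool_vec R x 0 i = (x i)%:R.
Proof. by rewrite mxE. Qed.

Lemma bool_vec_vupd x i t : bool_vec R (vupd x i t) = upd (bool_vec R x) i t%:R.
Proof. by apply/rowP => j; rewrite updE !mxE vupdE; case: eqP. Qed.

Lemma cube_bool_vec x : cube (bool_vec R x).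
Proof. by move=> i; rewrite bool_vecE; case: (x i); rewrite lexx ler01. Qed.

(** Flipping the [i]-th bit is an involution, so it suffices to compare the sums over the two ends
    of each edge in direction [i]. *)
Lemma sum_vertices_pairing (F H : {ffun 'I_n -> bool} -> R) i :
  (forall x, F (vupd x i true) + F (vupd x i false) <=
             H (vupd x i true) + H (vupd x i false)) ->
  \sum_x F x <= \sum_x H x.
Proof.
move=> FH; pose flip x := vupd x i (~~ x i).
have flipK : involutive flip.
  move=> x; apply/ffunP => j; rewrite /flip !vupdE eqxx.
  by case: eqP => // ->; rewrite negbK.
have double (G : {ffun 'I_n -> bool} -> R) :
    2 * \sum_x G x = \sum_x (G (vupd x i true) + G (vupd x i false)).
  rewrite mulr2n mulrDl mul1r.
  rewrite [X in _ + X](reindex_inj (inv_inj flipK)) -big_split/=.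
  apply: eq_bigr => x _; rewrite -[in G x](vupd_id x i) /flip.
  by case: (x i) => //=; rewrite addrC.
have : 2 * \sum_x F x <= 2 * \sum_x H x.
  by rewrite !double; apply: ler_sum => x _.
by rewrite ler_pM2l.
Qed.

End vertices.

Section conditional_mean.
Context {R : realType} {n : nat}.
Implicit Types (x : {ffun 'I_n -> bool}) (i j : 'I_n).
Variables (w : {ffun 'I_n -> bool} -> R) (m : {ffun 'I_n -> bool} -> 'rV[R]_n).

(* The [i]-th coordinate of [m x] is the mean of the [i]-th coordinate of a
   random vertex with density proportional to [w], given that the other
   coordinates are those of [x]. *)
Definition conditional_mean : Prop :=
  [/\ forall x, 0 <= w x, forall x, cube (m x),
      forall x i t, m (vupd x i t) 0 i = m x 0 i &
      forall x i, w (vupd x i true) * (1 - m x 0 i) =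
                  w (vupd x i false) * m x 0 i].

Hypothesis wm : conditional_mean.

(* Exchangeable-pair argument: each summand [(x_i - m_i) v_i] of [h] has
   conditional mean zero when its factor is frozen in the direction [i], so
   its correlation with [h] is controlled by the variation of [v_i] and [h]
   in that direction. *)
Lemma centered_second_moment (v : 'I_n -> {ffun 'I_n -> bool} -> R)
    (h : {ffun 'I_n -> bool} -> R) (B : 'I_n -> R) :
  (forall x, h x = \sum_i (bool_vec R x 0 i - m x 0 i) * v i x) ->
  (forall i x, m x 0 i * (1 - m x 0 i) *
     (`|v i (vupd x i true) - v i (vupd x i false)| * `|h (vupd x i true)|
      + `|v i (vupd x i false)| * `|h (vupd x i true) - h (vupd x i false)|)
     <= B i) ->
  \sum_x w x * h x ^+ 2 <= (\sum_i B i) * \sum_x w x.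
Proof.
move=> hE HB; have [w0 mc mi wm'] := wm.
have -> : \sum_x w x * h x ^+ 2 =
    \sum_i \sum_x w x * ((bool_vec R x 0 i - m x 0 i) * v i x * h x).
  rewrite exchange_big/=; apply: eq_bigr => x _.
  rewrite -mulr_sumr; congr (_ * _).
  by rewrite -mulr_suml -hE expr2.
rewrite mulr_suml; apply: ler_sum => i _.
rewrite mulr_sumr; apply: (@sum_vertices_pairing _ _ _ _ i) => x.
rewrite !mi !bool_vecE !vupdE eqxx -mulrDr.
have := HB i x; have := wm' x i; have /andP[] := mc x i.
have := w0 (vupd x i false); have := w0 (vupd x i true).
set r := m x 0 i; set wt := w _; set wf := w _; set vt := v i _.
set vf := v i _; set ht := h _; set hf := h _.
move=> wt0 wf0 r0 r1 E H.
have -> : wt * ((true%:R - r) * vt * ht) + wf * ((false%:R - r) * vf * hf) =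
    r * (1 - r) * ((vt - vf) * ht + vf * (ht - hf)) * (wt + wf).
  rewrite -[true%:R]/(1 : R) -[false%:R]/(0 : R).
  transitivity (wt * (1 - r) * vt * ht - wf * r * vf * hf); first by ring.
  transitivity ((r * (wt * (1 - r)) + (1 - r) * (wf * r)) *
    ((vt - vf) * ht + vf * (ht - hf))); last by ring.
  by rewrite -E; ring.
rewrite ler_wpM2r ?addr_ge0//; apply: le_trans H.
rewrite ler_wpM2l ?mulr_ge0 ?subr_ge0// lerD//;
  by rewrite (le_trans (ler_norm _))// normrM.
Qed.

(** The factor 1/4 is the maximum of [m (1 - m)]; [rho] accounts for the variation of [v i] and
    [eta] for that of [h]. *)
Lemma centered_second_moment_quarter (v : 'I_n -> {ffun 'I_n -> bool} -> R)
    (h : {ffun 'I_n -> bool} -> R) (beta rho eta : 'I_n -> R) :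
  (forall x, h x = \sum_i (bool_vec R x 0 i - m x 0 i) * v i x) ->
  (forall i x, `|v i x| <= beta i) ->
  (forall i x, `|v i (vupd x i true) - v i (vupd x i false)|
               * `|h (vupd x i true)| <= rho i) ->
  (forall i x, `|h (vupd x i true) - h (vupd x i false)| <= eta i) ->
  \sum_x w x * h x ^+ 2 <=
  (4^-1 * \sum_i (rho i + beta i * eta i)) * \sum_x w x.
Proof.
move=> hE vb vr he; rewrite [4^-1 * _]mulr_sumr.
apply: centered_second_moment hE _ => i x.
have [_ mc _ _] := wm; have /andP[m0 m1] := mc x i.
apply: ler_pM.
- by rewrite mulr_ge0 ?subr_ge0.
- by rewrite addr_ge0 ?mulr_ge0.
- by have := sqr_ge0 (2 * m x 0 i - 1); lra.
- by rewrite lerD// ler_pM.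
Qed.

End conditional_mean.

(** * Comparison of [g] at a random vertex and at its conditional means *)

Section mean_field_approximation.
Context {R : realType} {n : nat}.
Implicit Types (x : {ffun 'I_n -> bool}) (i j : 'I_n).
Context {g : 'rV[R]_n -> R} {g1 : 'I_n -> 'rV[R]_n -> R}
  {a : R} {b : 'I_n -> R} {c : 'I_n -> 'I_n -> R}.
Hypothesis gC11 : C11_on_cube g g1 b c.
Hypothesis g_le : forall y : 'rV[R]_n, cube y -> `|g y| <= a.
Variables (w : {ffun 'I_n -> bool} -> R) (m : {ffun 'I_n -> bool} -> 'rV[R]_n).
Variable e : 'I_n -> 'I_n -> R.
Hypothesis wm : conditional_mean w m.
Hypothesis m_lip : forall x i j,
  `|m (vupd x i true) 0 j - m (vupd x i false) 0 j| <= e i j.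

(** Along the path from [m x] to the vertex, the mean value theorem writes each increment of [g] as
    [x_i - m_i] times a value of [g1 i], which is the form required by the exchangeable-pair
    estimate. *)
Lemma mean_field_second_moment :
  \sum_x w x * (g (bool_vec R x) - g (m x)) ^+ 2 <=
  (4^-1 * \sum_i ((c i i + \sum_j c j i * e i j) * (2 * a)
                  + b i * (b i + \sum_j b j * e i j))) * \sum_x w x.
Proof.
have [_ mc mi _] := wm.
have cV x : cube (bool_vec R x) by exact: cube_bool_vec.
have e0 i j : 0 <= e i j by exact: le_trans (m_lip 0 i j).
have c0 := C11_c_ge0 gC11; have b0 := C11_b_ge0 gC11.
pose z i x := hybrid (bool_vec R x) (m x) i.
have cz i x : cube (z i x) by exact: cube_hybrid.
(* The intermediate points depend arbitrarily on the vertex. This is harmless: moving the [i]-th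
   coordinate within [0, 1] changes [g1 i] by at most [c i i]. *)
have /choice[xi Hxi] (q : 'I_n * {ffun 'I_n -> bool}) : exists t : R,
    0 <= t <= 1 /\
    g (hybrid (bool_vec R q.2) (m q.2) q.1.+1) - g (z q.1 q.2) =
      (bool_vec R q.2 0 q.1 - m q.2 0 q.1) * g1 q.1 (upd (z q.1 q.2) q.1 t).
  case: q => i x /=.
  have [t t01 E] := C11_MVT gC11 i (cz i x) (cV x i) (mc x i).
  by exists t; split => //; rewrite hybridS -E -hybrid_upd.
apply: (@centered_second_moment_quarter _ _ w m wm
  (fun i x => g1 i (upd (z i x) i (xi (i, x))))).
- move=> x; rewrite telescope_hybrid; apply: eq_bigr => i _.
  by have [] := Hxi (i, x).
- move=> i x; apply: (C11_bound gC11); apply: cube_upd => //.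
  by have [] := Hxi (i, x).
- move=> i x; apply: ler_pM => //; last first.
    apply: (le_trans (ler_normB _ _)); rewrite mulr2n mulrDl mul1r.
    by rewrite lerD ?g_le.
  have xt := (Hxi (i, vupd x i true)).1; have xf := (Hxi (i, vupd x i false)).1.
  (* Flipping [x_i] moves the [i]-th coordinate of the argument by at most 1; the others are either
     taken from [x], hence fixed, or taken from [m], hence moved by at most [e i j]. *)
  apply: (le_trans (C11_gradient_lipschitz gC11 _ _ _)); try exact: cube_upd.
  rewrite (bigD1 i)//= !updE eqxx lerD//.
    rewrite -[leRHS]mulr1 ler_wpM2l// ler_norml; lra.
  rewrite [leRHS](bigD1 i)//= -[leLHS]add0r lerD ?mulr_ge0//.
  apply: ler_sum => j ji; rewrite ler_wpM2l// !updE (negbTE ji).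
  rewrite /z !mxE; case: ifP => _; last exact: m_lip.
  by rewrite !vupdE (negbTE ji) subrr normr0.
- move=> i x.
  have -> : forall p q r s : R, p - q - (r - s) = (p - r) + (s - q).
    by move=> *; ring.
  apply: (le_trans (ler_normD _ _)); apply: lerD.
    apply: (le_trans (C11_value_lipschitz gC11 _ _)) => //.
    rewrite (bigD1 i)//= big1 ?addr0 => [|j ji].
      by rewrite !bool_vecE !vupdE eqxx subr0 normr1 mulr1.
    by rewrite !bool_vecE !vupdE (negbTE ji) subrr normr0 mulr0.
  apply: (le_trans (C11_value_lipschitz gC11 _ _)) => //.
  by apply: ler_sum => j _; rewrite ler_wpM2l// distrC.
Qed.

End mean_field_approximation.

Lemma weighted_chebyshev (R : realType) (I : finType) (w h : I -> R)
    (s k : R) : (forall x, 0 <= w x) -> 0 <= k ->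
  \sum_x w x * h x ^+ 2 <= k * s ^+ 2 * \sum_x w x ->
  \sum_(x | s ^+ 2 < h x ^+ 2) w x <= k * \sum_x w x.
Proof.
move=> w0 k0 H; have W0 : 0 <= \sum_x w x by exact: sumr_ge0.
(* The strict inequality in the event makes [s = 0] admissible: the hypothesis then forces [w x = 0]
   wherever [h x] is nonzero. *)
have [s0|s0] := eqVneq s 0.
  rewrite big1 ?mulr_ge0// => x hx; move: H; rewrite s0 expr0n/= mulr0 mul0r.
  move=> H; have : w x * h x ^+ 2 <= 0.
    apply: le_trans H; rewrite (bigD1 x)//= lerDl sumr_ge0// => y _.
    by rewrite mulr_ge0 ?sqr_ge0.
  rewrite s0 expr0n/= in hx; rewrite pmulr_lle0// => wx.
  by apply/eqP; rewrite eq_le wx w0.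
have s2 : 0 < s ^+ 2 by rewrite exprn_even_gt0.
rewrite -(ler_pM2r s2) mulrAC; apply: le_trans H.
rewrite mulr_suml [leRHS](bigID (fun x => s ^+ 2 < h x ^+ 2))/=.
rewrite -[leLHS]addr0 lerD ?sumr_ge0// => [|x _]; last first.
  by rewrite mulr_ge0 ?sqr_ge0.
by apply: ler_sum => x hx; rewrite ler_wpM2l// ltW.
Qed.

(** * Bernoulli products *)

Section bernoulli_product.
Context {R : realType}.
Implicit Types (p q s t : R) (b : bool).

Definition bern q b : R := if b then q else 1 - q.

Definition bern_vec n (q : 'rV[R]_n) (x : {ffun 'I_n -> bool}) : R :=
  \prod_i bern (q 0 i) (x i).

Lemma bern_ge0 q b : 0 <= q <= 1 -> 0 <= bern q b.
Proof. by case/andP=> q0 q1; case: b; rewrite ?subr_ge0. Qed.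

Lemma bern_gt0 q b : 0 < q < 1 -> 0 < bern q b.
Proof. by case/andP=> q0 q1; case: b; rewrite ?subr_gt0. Qed.

Lemma bern_vec_ge0 n (q : 'rV[R]_n) x : cube q -> 0 <= bern_vec q x.
Proof. by move=> cq; apply: prodr_ge0 => i _; exact: bern_ge0. Qed.

Lemma sum_bern_vec n (q : 'rV[R]_n) : \sum_x bern_vec q x = 1.
Proof.
rewrite /bern_vec -(bigA_distr_bigA (fun i b => bern (q 0 i) b)).
by apply: big1 => i _; rewrite big_bool/= addrC subrK.
Qed.

Lemma bern_vec_vupd n (q : 'rV[R]_n) x i b :
  bern_vec q (vupd x i b) =
  bern (q 0 i) b * \prod_(j | j != i) bern (q 0 j) (x j).
Proof.
rewrite /bern_vec (bigD1 i)//= vupdE eqxx; congr (_ * _).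
by apply: eq_bigr => j ji; rewrite vupdE (negbTE ji).
Qed.

Lemma conditional_mean_bern n (q : 'rV[R]_n) : cube q ->
  conditional_mean (bern_vec q) (fun=> q).
Proof.
move=> cq; split=> // [x|x i]; first exact: bern_vec_ge0.
by rewrite !bern_vec_vupd /=; ring.
Qed.

(** The derivative of [rel_entropy p] at [q], that is logit [q] minus logit [p], for [q] inside (0,
    1). *)
Definition log_odds_ratio p q : R := ln (q / p) - ln ((1 - q) / (1 - p)).

(** The log-likelihood ratio splits into its mean under Bernoulli([q]) and a centred part linear in
    the outcome. Only the observed outcome must have positive mass, so [q] may be 0 or 1. *)
Lemma bern_change_of_measure p q b : 0 < p < 1 -> 0 < bern q b ->
  bern q b =
  bern p b * expR (rel_entropy p q + (b%:R - q) * log_odds_ratio p q).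
Proof.
move=> /andP[p0 p1]; rewrite /rel_entropy /log_odds_ratio.
have p1' : 0 < 1 - p by rewrite subr_gt0.
case: b => /= q0.
  rewrite (_ : _ + _ = ln (q / p)); last by rewrite mulr1n; ring.
  by rewrite lnK ?posrE ?divr_gt0// mulrC divfK// gt_eqF.
rewrite (_ : _ + _ = ln ((1 - q) / (1 - p))); last by rewrite mulr0n; ring.
by rewrite lnK ?posrE ?divr_gt0// mulrC divfK// gt_eqF.
Qed.

Lemma bern_vec_change_of_measure n p (q : 'rV[R]_n) (x : {ffun 'I_n -> bool}) :
  0 < p < 1 -> (forall i, 0 < bern (q 0 i) (x i)) ->
  bern_vec q x = bern_vec (const_mx p) x *
    expR (rel_entropy_vec p q
          + \sum_i (bool_vec R x 0 i - q 0 i) * log_odds_ratio p (q 0 i)).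
Proof.
move=> p01 qx; rewrite -big_split expR_sum -big_split/=.
apply: eq_bigr => i _; rewrite mxE bool_vecE.
exact: bern_change_of_measure.
Qed.

(** The mean of the Bernoulli([p]) law reweighted by [expR (t * b)]; [t] is its log-odds relative to
    [p]. *)
Definition tilt p t : R := p * expR t / (p * expR t + (1 - p)).

Lemma tilt_den_gt0 p t : 0 < p < 1 -> 0 < p * expR t + (1 - p).
Proof.
by case/andP=> p0 p1; rewrite addr_gt0// ?subr_gt0// mulr_gt0// expR_gt0.
Qed.

Lemma one_minus_tilt p t : 0 < p < 1 ->
  1 - tilt p t = (1 - p) / (p * expR t + (1 - p)).
Proof.
move=> p01; have D := lt0r_neq0 (tilt_den_gt0 t p01).
by rewrite /tilt -{1}(divff D) -mulrBl addrAC subrr add0r.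
Qed.

Lemma tilt_itv p t : 0 < p < 1 -> 0 < tilt p t < 1.
Proof.
move=> p01; have D := tilt_den_gt0 t p01; case/andP: (p01) => p0 p1.
rewrite -[X in _ && X]subr_gt0 one_minus_tilt//.
by rewrite !divr_gt0// ?subr_gt0// mulr_gt0// expR_gt0.
Qed.

Lemma log_odds_ratio_tilt p t : 0 < p < 1 -> log_odds_ratio p (tilt p t) = t.
Proof.
move=> p01; have D := tilt_den_gt0 t p01; case/andP: (p01) => p0 p1.
rewrite /log_odds_ratio one_minus_tilt//.
have -> : tilt p t / p = expR t / (p * expR t + (1 - p)).
  by rewrite /tilt; field; rewrite !lt0r_neq0.
have -> : (1 - p) / (p * expR t + (1 - p)) / (1 - p) =
    (p * expR t + (1 - p))^-1.
  by field; rewrite !lt0r_neq0// subr_gt0.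
rewrite ln_div ?posrE ?expR_gt0// lnV ?posrE// expRK; ring.
Qed.

(** For [t <= s] the difference is [1 - expR (t - s)], which is at most [s - t], times a product of
    two probabilities. *)
Lemma tilt_lipschitz p s t : 0 < p < 1 -> `|tilt p s - tilt p t| <= `|s - t|.
Proof.
move=> p01; wlog ts : s t / t <= s.
  move=> H; have [/H//|/ltW /H] := leP t s.
  by rewrite distrC [in X in _ <= X -> _]distrC.
have Ds := tilt_den_gt0 s p01; have Dt := tilt_den_gt0 t p01.
case/andP: (p01) => p0 p1.
have -> : tilt p s - tilt p t = (1 - expR (t - s)) *
    (tilt p s * (1 - tilt p t)).
  rewrite one_minus_tilt// /tilt expRD expRN; field.
  by rewrite !lt0r_neq0// ?expR_gt0.
have /andP[s0 s1] := tilt_itv s p01; have /andP[t0 t1] := tilt_itv t p01.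
have e1 : 0 <= 1 - expR (t - s) by rewrite subr_ge0 -expR0 ler_expR subr_le0.
have u0 : 0 <= 1 - tilt p t by rewrite subr_ge0 ltW.
rewrite [X in X <= _]ger0_norm; last first.
  by apply: mulr_ge0 e1 (mulr_ge0 _ u0); exact: ltW.
rewrite ger0_norm ?subr_ge0//.
have := expR_ge1Dx (t - s) => H.
apply: (@le_trans _ _ (1 - expR (t - s))); last lra.
by rewrite ler_piMr// mulr_ile1 ?(ltW s0) ?(ltW s1)//; lra.
Qed.

(** The logarithm of a tilted mass is 1-Lipschitz in the tilt. Replacing the discrete gradient by a
    net point thus costs at most their l^1 distance in the exponent. *)
Lemma bern_tilt_le p s t b : 0 < p < 1 ->
  bern (tilt p s) b <= expR `|s - t| * bern (tilt p t) b.
Proof.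
move=> p01; case/andP: (p01) => p0 p1.
have Ds := tilt_den_gt0 s p01; have Dt := tilt_den_gt0 t p01.
have e1 : 1 <= expR `|s - t| by rewrite -expR0 ler_expR.
have p0' : 0 <= 1 - p by rewrite subr_ge0 ltW.
case: b => /=; rewrite ?one_minus_tilt// /tilt mulrA ler_pdivrMr//
  mulrAC ler_pdivlMr//.
  apply: (@le_trans _ _ (p * expR s * (p * expR t)
     + p * expR s * (1 - p))); first by rewrite mulrDr.
  have H : expR s <= expR `|s - t| * expR t.
    by rewrite -expRD ler_expR -lerBlDr ler_norm.
  have -> : expR `|s - t| * (p * expR t) * (p * expR s + (1 - p)) =
    expR `|s - t| * (p * expR t * (p * expR s))
    + (expR `|s - t| * expR t) * (p * (1 - p)) by ring.
  apply: lerD.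
    by rewrite [X in X <= _]mulrC ler_peMl// !mulr_ge0 ?expR_ge0// ltW.
  have -> : p * expR s * (1 - p) = expR s * (p * (1 - p)) by ring.
  by rewrite ler_wpM2r// mulr_ge0// ltW.
have H : expR t <= expR `|s - t| * expR s.
  by rewrite -expRD ler_expR -lerBlDr distrC ler_norm.
have -> : expR `|s - t| * (1 - p) * (p * expR s + (1 - p)) =
    (1 - p) * (p * (expR `|s - t| * expR s) + expR `|s - t| * (1 - p)) by ring.
rewrite ler_wpM2l// lerD ?ler_wpM2l ?(ltW p0)//.
by rewrite ler_peMl.
Qed.

Lemma bern_vec_tilt_le n p (s t : 'rV[R]_n) x : 0 < p < 1 ->
  bern_vec (map_mx (tilt p) s) x <=
  expR (\sum_i `|s 0 i - t 0 i|) * bern_vec (map_mx (tilt p) t) x.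
Proof.
move=> p01; rewrite expR_sum -big_split/=; apply: ler_prod => i _.
rewrite !mxE bern_tilt_le// andbT bern_ge0//.
by have /andP[/ltW-> /ltW->] := tilt_itv (s 0 i) p01.
Qed.

End bernoulli_product.

(** * The mean-field upper bound *)

Section mean_field_upper_bound.
Context {R : realType} {n : nat}.
Implicit Types (x : {ffun 'I_n -> bool}) (i j : 'I_n).
Context {g : 'rV[R]_n -> R} {g1 : 'I_n -> 'rV[R]_n -> R}
  {a : R} {b : 'I_n -> R} {c : 'I_n -> 'I_n -> R}.
Hypothesis gC11 : C11_on_cube g g1 b c.
Hypothesis g_le : forall y : 'rV[R]_n, cube y -> `|g y| <= a.
Variable p : R.
Hypothesis p01 : 0 < p < 1.

Let V x : 'rV[R]_n := bool_vec R x.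

Let diff x i := g (V (vupd x i true)) - g (V (vupd x i false)).

Let w x := bern_vec (const_mx p) x * expR (g (V x)).

Let m x : 'rV[R]_n := map_mx (tilt p) (\row_i diff x i).

Let mE x i : m x 0 i = tilt p (diff x i).
Proof. by rewrite !mxE. Qed.

Let cube_m x : cube (m x).
Proof.
by move=> i; rewrite mE; case/andP: (tilt_itv (diff x i) p01) => /ltW-> /ltW->.
Qed.

Let c0 : forall i j, 0 <= c i j := C11_c_ge0 gC11.
Let b0 : forall i, 0 <= b i := C11_b_ge0 gC11.

Let cubeV x : cube (V x).
Proof. exact: cube_bool_vec. Qed.

Let diff_vupd x i t : diff (vupd x i t) i = diff x i.
Proof.
by congr (g (V _) - g (V _)); apply/ffunP => j; rewrite !vupdE; case: eqP.
Qed.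

Let diff_bound x i : `|diff x i| <= b i.
Proof.
apply: (le_trans (C11_value_lipschitz gC11 (cubeV _) (cubeV _))).
rewrite (bigD1 i)//= big1 ?addr0 => [|j ji].
  by rewrite !bool_vecE !vupdE eqxx subr0 normr1 mulr1.
by rewrite !bool_vecE !vupdE (negbTE ji) subrr normr0 mulr0.
Qed.

Let diff_lip x i j :
  `|diff (vupd x i true) j - diff (vupd x i false) j| <= c i j.
Proof.
have [->|ij] := eqVneq i j; first by rewrite !diff_vupd subrr normr0.
rewrite /diff /V !bool_vec_vupd.
exact: (C11_mixed_difference gC11 (cubeV x) ij).
Qed.

(** On an edge in direction [i] the two weights are in the ratio [p * expR (diff x i)] to [1 - p],
    and [diff x i] is the same at both ends. *)
Let cond_mean : conditional_mean w m.
Proof.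
have p01' : 0 <= p <= 1 by case/andP: p01 => /ltW-> /ltW->.
split=> // [x|x i t|x i].
- by rewrite mulr_ge0 ?expR_ge0// bern_vec_ge0// => i; rewrite mxE.
- by rewrite !mE diff_vupd.
- rewrite !mE one_minus_tilt// /w !bern_vec_vupd /= mxE /tilt /diff.
  set B := \prod_(j | _) _; set u := g _; set v := g _.
  have D := tilt_den_gt0 (u - v) p01.
  have -> : expR u = expR (u - v) * expR v by rewrite -expRD subrK.
  by field; exact: lt0r_neq0.
Qed.

Let m_lip x i j : `|m (vupd x i true) 0 j - m (vupd x i false) 0 j| <= c i j.
Proof.
by rewrite !mE; apply: le_trans (diff_lip x i j); exact: tilt_lipschitz.
Qed.

(** The centred part of the log-likelihood ratio of [bern_vec (m x)] against the Bernoulli([p])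
    product, since [diff x i] is the log-odds ratio of [m x 0 i]. *)
Let llr x := \sum_i (V x 0 i - m x 0 i) * diff x i.

(** Here [v i = diff _ i] does not vary in direction [i], so [rho = 0]. Flipping [x_i] changes the
    [i]-th summand of [llr] by [diff x i], and the [j]-th through both [diff _ j] and [m _ 0 j]. *)
Let llr_second_moment : \sum_x w x * llr x ^+ 2 <=
  (4^-1 * \sum_i b i * (b i + \sum_j (c i j + b j * c i j))) * \sum_x w x.
Proof.
have -> : \sum_i b i * (b i + \sum_j (c i j + b j * c i j)) =
    \sum_i (0 + b i * (b i + \sum_j (c i j + b j * c i j))).
  by apply: eq_bigr => i _; rewrite add0r.
apply: (centered_second_moment_quarter cond_mean
  (v := fun i x => diff x i)) => //.
  by move=> i x; rewrite !diff_vupd subrr normr0 mul0r.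
move=> i x; rewrite /llr -sumrB.
have E t : V (vupd x i t) 0 i - m (vupd x i t) 0 i = t%:R - m x 0 i.
  by rewrite !mE diff_vupd /V bool_vecE vupdE eqxx.
rewrite (bigD1 i)//= !diff_vupd !E -mulrBl opprB addrA subrK subr0 mul1r.
apply: (le_trans (ler_normD _ _)); apply: lerD => //.
apply: (le_trans (ler_norm_sum _ _ _)).
rewrite [leRHS](bigD1 i)//= -[leLHS]add0r lerD ?addr_ge0 ?mulr_ge0//.
apply: ler_sum => j ji.
have Et t : V (vupd x i t) 0 j = V x 0 j.
  by rewrite /V !bool_vecE vupdE (negbTE ji).
rewrite !Et; have := m_lip x i j; have := diff_lip x i j.
set dt := diff _ j; set df := diff _ j; set mt := m _ 0 j; set mf := m _ 0 j.
move=> Hd Hm; have -> : (V x 0 j - mt) * dt - (V x 0 j - mf) * df =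
  (V x 0 j - mt) * (dt - df) + df * (mf - mt) by ring.
apply: (le_trans (ler_normD _ _)); rewrite !normrM; apply: lerD.
  rewrite -[leRHS]mul1r ler_pM// ler_norml.
  have /andP[u0 u1] := cubeV x j; have /andP[v0 v1] := cube_m (vupd x i true) j.
  by rewrite -/mt in v0 v1 *; apply/andP; split; lra.
apply: ler_pM => //; first exact: diff_bound.
by rewrite [leLHS]distrC.
Qed.

(** With [alpha], [beta], [gamma] for [a], [b], [c], this is the radicand in [smoothness_term]. *)
Definition mean_field_error : R :=
  \sum_i (a * c i i + b i ^+ 2)
  + 4^-1 * \sum_i \sum_j (a * c i j ^+ 2 + b i * b j * c i j + 4 * b i * c i j).

Let a0 : 0 <= a.
Proof. exact: le_trans (g_le cube0). Qed.

Lemma mean_field_error_ge0 : 0 <= mean_field_error.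
Proof.
rewrite addr_ge0 ?mulr_ge0 ?sumr_ge0// => i _.
  by rewrite addr_ge0 ?sqr_ge0 ?mulr_ge0.
by apply: sumr_ge0 => j _; rewrite !addr_ge0 ?mulr_ge0 ?sqr_ge0.
Qed.

Let dev x := g (V x) - g (m x) - llr x.

(** Stated so that Chebyshev's inequality at [4 * Num.sqrt mean_field_error] leaves out at most a
    quarter of the mass. *)
Let dev_second_moment : \sum_x w x * dev x ^+ 2 <=
  4^-1 * (4 * Num.sqrt mean_field_error) ^+ 2 * \sum_x w x.
Proof.
have [w0 _ _ _] := cond_mean.
have W0 : 0 <= \sum_x w x by exact: sumr_ge0.
have H := mean_field_second_moment gC11 g_le cond_mean m_lip.
have H' := llr_second_moment.
apply: (@le_trans _ _ (2 * (\sum_x w x * (g (V x) - g (m x)) ^+ 2)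
   + 2 * \sum_x w x * llr x ^+ 2)).
  rewrite !mulr_sumr -big_split/=; apply: ler_sum => x _.
  rewrite !(mulrCA 2) -mulrDr ler_wpM2l//.
  rewrite /dev; set u := g _ - _; have := sqr_ge0 (u + llr x); nra.
apply: le_trans (lerD (ler_wpM2l (ler0n _ 2) H) (ler_wpM2l (ler0n _ 2) H')) _.
rewrite [2 * _]mulrA [2 * (_ * \sum_i w i)]mulrA -mulrDl ler_wpM2r//.
rewrite exprMn sqr_sqrtr ?mean_field_error_ge0//.
rewrite /mean_field_error.
(* In these terms the claim is [A + X + B + Y + Z / 2 <= 4 A + 4 B + C + Y + 4 Z]. *)
pose A := \sum_i a * c i i; pose B := \sum_i b i ^+ 2.
pose C := \sum_i \sum_j a * c i j ^+ 2.
pose X := \sum_i \sum_j a * (c j i * c i j).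
pose Y := \sum_i \sum_j b i * b j * c i j.
pose Z := \sum_i \sum_j b i * c i j.
have -> : \sum_i ((c i i + \sum_j c j i * c i j) * (2 * a)
                  + b i * (b i + \sum_j b j * c i j)) =
    2 * A + 2 * X + B + Y.
  rewrite /A /X /B /Y !mulr_sumr -!big_split/=; apply: eq_bigr => i _.
  rewrite mulrDl mulrDr -expr2 mulr_suml !mulr_sumr addrA.
  congr (_ + _ + _ + _); first by ring.
    by apply: eq_bigr => j _; ring.
  by apply: eq_bigr => j _; ring.
have -> : \sum_i b i * (b i + \sum_j (c i j + b j * c i j)) = B + Y + Z.
  rewrite /B /Y /Z -!big_split/=; apply: eq_bigr => i _.
  rewrite mulrDr -expr2 -addrA; congr (_ + _).
  rewrite mulr_sumr -big_split/=; apply: eq_bigr => j _; ring.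
have -> : \sum_i (a * c i i + b i ^+ 2) = A + B by rewrite big_split.
have -> : \sum_i \sum_j (a * c i j ^+ 2 + b i * b j * c i j + 4 * b i * c i j)
    = C + Y + 4 * Z.
  rewrite /C /Y /Z mulr_sumr -!big_split/=; apply: eq_bigr => i _.
  by rewrite mulr_sumr -!big_split/=; apply: eq_bigr => j _; ring.
(* [c] is not assumed symmetric, so [c i j * c j i] is bounded by the mean of the two squares. *)
have XC : X <= C.
  have : 2 * X <= C + C.
    rewrite {2}/C exchange_big/= /C /X -big_split/= mulr_sumr.
    apply: ler_sum => i _; rewrite -big_split/= mulr_sumr.
    apply: ler_sum => j _; rewrite -mulrDr mulrCA ler_wpM2l//.
    have := sqr_ge0 (c i j - c j i); nra.
  lra.
have A0 : 0 <= A by apply: sumr_ge0 => i _; rewrite mulr_ge0.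
have B0 : 0 <= B by apply: sumr_ge0 => i _; rewrite sqr_ge0.
have Y0 : 0 <= Y.
  by apply: sumr_ge0 => i _; apply: sumr_ge0 => j _; rewrite !mulr_ge0.
have Z0 : 0 <= Z.
  by apply: sumr_ge0 => i _; apply: sumr_ge0 => j _; rewrite !mulr_ge0.
have -> : (4 : R) ^+ 2 = 16 by ring.
lra.
Qed.

(** A change of measure gives [w x] as [bern_vec (m x) x] times the exponential of [g - I_p] at
    [m x] plus [dev x], and [m x] lies in the cube. The product is moved to a net point [k], which
    depends on [x]; summing over all [k] removes this dependence. *)
Let bulk_le (M r : R) (K : finType) (theta : K -> 'rV[R]_n) :
  (forall y : 'rV[R]_n, cube y -> g y - rel_entropy_vec p y <= M) ->
  (forall x, exists k, \sum_i `|g1 i (V x) - theta k 0 i| <= r) ->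
  forall x, dev x ^+ 2 <= (4 * Num.sqrt mean_field_error) ^+ 2 ->
  w x <= expR (M + 4 * Num.sqrt mean_field_error + r + \sum_i c i i)
         * \sum_k bern_vec (map_mx (tilt p) (theta k)) x.
Proof.
move=> gM net x dx; set s := 4 * Num.sqrt _ in dx *.
have {}dx : dev x <= s.
  by rewrite (le_trans (ler_norm _))// -(ler_sqr (normr_nneg _))
    ?real_normK ?num_real// nnegrE mulr_ge0// sqrtr_ge0.
have [k Hk] := net x.
have mx_pos i : 0 < bern (m x 0 i) (x i).
  by apply: bern_gt0; rewrite mE tilt_itv.
have wE : w x = bern_vec (m x) x *
    expR (g (m x) - rel_entropy_vec p (m x) + dev x).
  rewrite /w (bern_vec_change_of_measure p01 mx_pos) -mulrA -expRD.
  congr (_ * expR _).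
  rewrite (_ : \sum_i _ = llr x) /dev; first by ring.
  by apply: eq_bigr => i _; rewrite mE log_odds_ratio_tilt// -mE.
have H1 := bern_vec_tilt_le (\row_i diff x i) (theta k) x p01.
have H2 : bern_vec (map_mx (tilt p) (theta k)) x <=
    \sum_k bern_vec (map_mx (tilt p) (theta k)) x.
  rewrite (bigD1 k)//= lerDl sumr_ge0// => k' _; apply: bern_vec_ge0 => i.
  by rewrite mxE; case/andP: (tilt_itv (theta k' 0 i) p01) => /ltW-> /ltW->.
(* By the mean value theorem [diff x i] is a value of [g1 i] on the edge through [x], hence within
   [c i i] of its value at [x]. *)
have H3 : \sum_i `|(\row_i diff x i) 0 i - theta k 0 i| <= r + \sum_i c i i.
  apply: (@le_trans _ _ (\sum_i (`|g1 i (V x) - theta k 0 i| + c i i))).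
    apply: ler_sum => i _; rewrite mxE [leRHS]addrC.
    have -> : diff x i - theta k 0 i =
      (diff x i - g1 i (V x)) + (g1 i (V x) - theta k 0 i) by ring.
    apply: (le_trans (ler_normD _ _)); rewrite lerD2r.
    have le01 : 0 <= (1 : R) <= 1 by rewrite ler01 lexx.
    have le00 : 0 <= (0 : R) <= 1 by rewrite ler01 lexx.
    have [t t01 E] := C11_MVT gC11 i (cubeV x) le01 le00.
    rewrite /diff /V !bool_vec_vupd E subr0 mul1r.
    apply: (le_trans (C11_lipschitz gC11 _ _ (cubeV x) t01)).
    rewrite -[leRHS]mulr1 ler_wpM2l// ler_norml.
    by have /andP[u0 u1] := cubeV x i; case/andP: t01 => v0 v1; lra.
  by rewrite big_split lerD2r.
rewrite wE.
have -> : M + s + r + \sum_i c i i = (r + \sum_i c i i) + (M + s) by ring.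
rewrite [expR (_ + (M + s))]expRD [leRHS]mulrAC.
apply: ler_pM; rewrite ?expR_ge0//.
- exact: bern_vec_ge0.
- apply: (le_trans H1); apply: ler_pM; rewrite ?expR_ge0 ?ler_expR//.
  apply: bern_vec_ge0 => i.
  by rewrite mxE; case/andP: (tilt_itv (theta k 0 i) p01) => /ltW-> /ltW->.
- by rewrite ler_expR lerD// gM.
Qed.

(** Each net point contributes total mass 1, whence the factor [#|K|]. The exceptional vertices
    carry at most a quarter of the weight, so the total is at most 4/3, hence 2, times the bulk. *)
Lemma mean_field_upper_bound (M r : R) (K : finType) (theta : K -> 'rV[R]_n) :
  (forall y : 'rV[R]_n, cube y -> g y - rel_entropy_vec p y <= M) ->
  (forall x, exists k, \sum_i `|g1 i (bool_vec R x) - theta k 0 i| <= r) ->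
  \sum_x bern_vec (const_mx p) x * expR (g (bool_vec R x)) <=
  2 * #|K|%:R *
  expR (M + 4 * Num.sqrt mean_field_error + r + \sum_i c i i).
Proof.
move=> gM net; have [w0 _ _ _] := cond_mean.
have W0 : 0 <= \sum_x w x by exact: sumr_ge0.
set s := 4 * Num.sqrt _.
have k0 : (0 : R) <= 4^-1 by rewrite invr_ge0.
have := weighted_chebyshev w0 k0 dev_second_moment; rewrite -/s => H.
set E := expR _.
have bulk : \sum_(x | ~~ (s ^+ 2 < dev x ^+ 2)) w x <= #|K|%:R * E.
  apply: (@le_trans _ _ (\sum_x E *
      \sum_k bern_vec (map_mx (tilt p) (theta k)) x)).
    rewrite [leRHS](bigID (fun x => ~~ (s ^+ 2 < dev x ^+ 2)))/=.
    rewrite -[leLHS]addr0 lerD//.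
      by apply: ler_sum => x; rewrite -leNgt => dx; apply: bulk_le.
    apply: sumr_ge0 => x _; rewrite mulr_ge0 ?expR_ge0// sumr_ge0// => k _.
    apply: bern_vec_ge0 => i; rewrite mxE.
    by case/andP: (tilt_itv (theta k 0 i) p01) => /ltW-> /ltW->.
  rewrite -mulr_sumr exchange_big/= mulrC.
  rewrite (eq_bigr (fun=> 1)) => [|k _]; last exact: sum_bern_vec.
  by rewrite sumr_const -mulr_natl mulr1.
have split : \sum_x w x = \sum_(x | s ^+ 2 < dev x ^+ 2) w x
    + \sum_(x | ~~ (s ^+ 2 < dev x ^+ 2)) w x.
  by rewrite (bigID (fun x => s ^+ 2 < dev x ^+ 2)).
change (\sum_x w x <= 2 * #|K|%:R * E); rewrite -mulrA.
move: H bulk W0 split.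
set W := \sum_x w x; set P := \sum_(x | _) _; set Q := \sum_(x | _) _.
by set N := _ * E; lra.
Qed.

End mean_field_upper_bound.

Arguments mean_field_error {R n} a b c.

(** * The law of the vertex and the lower bound *)

Section vertex_law.
Context d (T : measurableType d) (R : realType) (P : probability T R) (n : nat).
Variables (p : R) (Y : 'I_n -> {RV P >-> bool}).
Hypothesis p01 : 0 < p < 1.
Hypothesis Y_bernoulli : forall i, distribution P (Y i) =1 bernoulli_prob p.
Hypothesis Y_indep : mutually_independent Y.

Let bernoulli1 i b : P (Y i @^-1` [set b]) = (bern p b)%:E.
Proof.
rewrite -[LHS]/(distribution P (Y i) [set b]) Y_bernoulli.
have p01' : 0 <= p <= 1 by case/andP: p01 => /ltW-> /ltW->.
by rewrite /bernoulli_prob p01' fsbig_set1; case: b.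
Qed.

(** The event is the finite disjoint union, over the vertices satisfying [Q], of the events that [Y]
    equals that vertex; independence over the full index set gives their masses. *)
Lemma probability_bool_vec (Q : pred 'rV[R]_n) :
  P [set w | Q (bool_vec R (Y ^~ w))] =
  (\sum_(x : {ffun 'I_n -> bool} | Q (bool_vec R x))
     bern_vec (const_mx p) x)%:E.
Proof.
pose E (x : {ffun 'I_n -> bool}) :=
  \bigcap_(i in [set` [set: 'I_n]%SET]) (Y i @^-1` [set x i]).
have EP x w : E x w <-> x = [ffun i => Y i w].
  split=> [Exw|-> i _]; last by rewrite ffunE.
  by apply/ffunP => i; rewrite ffunE (Exw i)//= inE.
have mE x : measurable (E x).
  apply: fin_bigcap_measurable => // i _.
  by rewrite -[X in measurable X]setTI; exact: measurable_funP.
have -> : [set w | Q (bool_vec R (Y ^~ w))] =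
    \bigcup_(x in [set` [pred x : {ffun 'I_n -> bool} | Q (bool_vec R x)]]) E x.
  have bE w : bool_vec R (Y ^~ w) = bool_vec R [ffun i => Y i w].
    by apply/rowP => i; rewrite !mxE ffunE.
  apply/seteqP; split=> w /=.
    by move=> Qw; exists [ffun i => Y i w]; [rewrite /= inE -bE|exact/EP].
  by case=> x /= + /EP xE; rewrite xE inE -bE.
rewrite measure_fin_bigcup//; last first.
  by move=> x y _ _ [w [/EP-> /EP->]].
rewrite -(@bigfs _ _ _ _ (index_enum _)) ?index_enum_uniq//=; last first.
  by move=> x _; rewrite mem_index_enum.
rewrite -sumEFin; apply: eq_bigr => x _; rewrite /E Y_indep//.
rewrite /bern_vec -prodEFin; apply: eq_big => i; first by rewrite inE.
by move=> _; rewrite bernoulli1 mxE.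
Qed.

End vertex_law.

(** With [u] and [v] the square roots of [q] and [1 - q], the log-odds of [q] is [2 ln (u / v)].
    Then [u v |ln (u / v)| <= 1] follows from [ln z <= z], and [u v <= 1/2] handles the log-odds of
    [p]. *)
Lemma log_odds_second_moment (R : realType) (p q : R) :
  0 < p < 1 -> 0 <= q <= 1 ->
  q * (1 - q) * log_odds_ratio p q ^+ 2 <=
  (2 + `|ln (p / (1 - p))| / 2) ^+ 2.
Proof.
move=> /andP[p0 p1] /andP[q0 q1]; set l := `|_|.
have l0 : 0 <= l by exact: normr_ge0.
have [->|q0'] := eqVneq q 0; first by rewrite !mul0r sqr_ge0.
have [->|q1'] := eqVneq q 1; first by rewrite subrr mulr0 mul0r sqr_ge0.
have {q0'}q0 : 0 < q by rewrite lt_neqAle eq_sym q0'.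
have {q1'}q1 : 0 < 1 - q by rewrite subr_gt0 lt_neqAle q1'.
have p1' : 0 < 1 - p by rewrite subr_gt0.
pose u := Num.sqrt q; pose v := Num.sqrt (1 - q).
have u0 : 0 < u by rewrite sqrtr_gt0.
have v0 : 0 < v by rewrite sqrtr_gt0.
have uE : q = u ^+ 2 by rewrite sqr_sqrtr// ltW.
have vE : 1 - q = v ^+ 2 by rewrite sqr_sqrtr// ltW.
have E : log_odds_ratio p q = 2 * ln (u / v) - ln (p / (1 - p)).
  rewrite /log_odds_ratio !ln_div ?posrE//.
  by rewrite vE [in ln q]uE !lnXn// !mulr2n; ring.
have uv1 : u ^+ 2 + v ^+ 2 = 1 by rewrite -uE -vE; ring.
have H x y : 0 < x -> 0 < y -> x ^+ 2 + y ^+ 2 = 1 -> x * y * ln (x / y) <= 1.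
  move=> x0 y0 xy1; apply: (@le_trans _ _ (x * y * (x / y))).
    by rewrite ler_wpM2l// ?mulr_ge0 ?ltW// ln_sublinear// divr_gt0.
  rewrite mulrA mulrAC mulfK ?gt_eqF//; have := sqr_ge0 y; nra.
rewrite E; have -> : q * (1 - q) = (u * v) ^+ 2 by rewrite exprMn -uE -vE.
rewrite -exprMn.
have K : `|u * v * ln (u / v)| <= 1.
  rewrite ler_norml H// andbT lerNl -mulrN -lnV ?posrE ?divr_gt0// invf_div.
  by rewrite [u * v]mulrC H// addrC.
have uv2 : u * v <= 2^-1 by have := sqr_ge0 (u - v); nra.
rewrite -[leLHS]real_normK ?num_real// ler_sqr ?nnegrE ?normr_ge0//;
  last by rewrite addr_ge0// divr_ge0.
rewrite mulrBr (le_trans (ler_normB _ _))// lerD//.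
  by rewrite mulrCA normrM ger0_norm// -[leRHS]mulr1 ler_wpM2l.
rewrite normrM -/l ger0_norm; last by rewrite mulr_ge0 ?ltW.
by rewrite mulrC ler_wpM2l.
Qed.

Section change_of_measure.
Context {R : realType} {n : nat}.
Implicit Types (x : {ffun 'I_n -> bool}) (i j : 'I_n).
Context {f : 'rV[R]_n -> R} {f1 : 'I_n -> 'rV[R]_n -> R}
  {a : R} {b : 'I_n -> R} {c : 'I_n -> 'I_n -> R}.
Hypothesis fC11 : C11_on_cube f f1 b c.
Hypothesis f_le : forall y : 'rV[R]_n, cube y -> `|f y| <= a.
Variable p : R.
Hypothesis p01 : 0 < p < 1.

(** Under the product law with means [y], Chebyshev's inequality discards two events of mass at most
    1/4. On the remaining half, [f] is at least [t] and the likelihood ratio is at most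
    [expR (rel_entropy_vec p y + r)]. *)
Lemma bernoulli_lower_bound (y : 'rV[R]_n) (t : R) :
  cube y -> t + 2 * Num.sqrt (\sum_i (a * c i i + b i ^+ 2)) <= f y ->
  expR (- rel_entropy_vec p y
        - Num.sqrt n%:R * (4 + `|ln (p / (1 - p))|)) <=
  2 * \sum_(x : {ffun 'I_n -> bool} | t <= f (bool_vec R x))
        bern_vec (const_mx p) x.
Proof.
move=> cy; set S := \sum_i _; set l := `|_| => ty.
have a0 : 0 <= a by exact: le_trans (f_le cube0).
have c0 := C11_c_ge0 fC11; have b0 := C11_b_ge0 fC11.
pose w := bern_vec y.
have w0 x : 0 <= w x by exact: bern_vec_ge0.
have wm : conditional_mean w (fun=> y) by exact: conditional_mean_bern.
have W1 : \sum_x w x = 1 by exact: sum_bern_vec.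
have k0 : (0 : R) <= 4^-1 by rewrite invr_ge0.
pose s := 2 * Num.sqrt S.
pose h (x : {ffun 'I_n -> bool}) := f (bool_vec R x) - f y.
have S0 : 0 <= S.
  by apply: sumr_ge0 => i _; rewrite addr_ge0 ?mulr_ge0 ?sqr_ge0.
have bad_f : \sum_(x | s ^+ 2 < h x ^+ 2) w x <= 4^-1.
  rewrite -[leRHS]mulr1 -[X in _ * X]W1; apply: weighted_chebyshev => //.
  (* The conditional means are the constant [y], so their variation matrix [e] is 0. *)
  have le0 x i j : `|y 0 j - y 0 j| <= 0.
    by rewrite subrr normr0.
  have H := mean_field_second_moment (e := fun _ _ => 0) fC11 f_le wm le0.
  apply: (le_trans H); rewrite W1 !mulr1 exprMn sqr_sqrtr//.
  rewrite mulrA; have -> : 4^-1 * 2 ^+ 2 = 1 :> R by field.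
  rewrite mul1r mulr_sumr; apply: ler_sum => i _.
  rewrite !big1 => [|j _|j _]; rewrite ?mulr0// !addr0 -expr2.
  have := sqr_ge0 (b i); have := mulr_ge0 a0 (c0 i i); nra.
pose llr (x : {ffun 'I_n -> bool}) :=
  \sum_i (bool_vec R x 0 i - y 0 i) * log_odds_ratio p (y 0 i).
(* Twice the bound [Num.sqrt n * (2 + l / 2)] on the standard deviation of [llr]. *)
pose r := Num.sqrt n%:R * (4 + l).
have r0 : 0 <= r by rewrite mulr_ge0 ?sqrtr_ge0 ?addr_ge0 ?normr_ge0.
have bad_llr : \sum_(x | r ^+ 2 < llr x ^+ 2) w x <= 4^-1.
  rewrite -[leRHS]mulr1 -[X in _ * X]W1; apply: weighted_chebyshev => //.
  have := centered_second_moment wm (h := llr)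
    (v := fun i _ => log_odds_ratio p (y 0 i))
    (B := fun i => (2 + l / 2) ^+ 2).
  move=> /(_ (fun x => erefl)) H.
  apply: (le_trans (H _)) => [i x|].
    rewrite subrr normr0 mul0r add0r.
    have -> : llr (vupd x i true) - llr (vupd x i false) =
        log_odds_ratio p (y 0 i).
      rewrite /llr -sumrB (bigD1 i)//= big1 ?addr0 => [|j ji].
        by rewrite !bool_vecE !vupdE eqxx -mulrBl opprB addrA subrK subr0 mul1r.
      by rewrite !bool_vecE !vupdE (negbTE ji) subrr.
    by rewrite -normrM -expr2 ger0_norm ?sqr_ge0// log_odds_second_moment.
  rewrite W1 !mulr1 sumr_const card_ord -mulr_natl.
  rewrite /r exprMn sqr_sqrtr ?ler0n// le_eqVlt; apply/orP; left.
  by apply/eqP; field.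
have cover x : w x <= (if s ^+ 2 < h x ^+ 2 then w x else 0)
    + (if r ^+ 2 < llr x ^+ 2 then w x else 0)
    + (if t <= f (bool_vec R x) then
         expR (rel_entropy_vec p y + r) * bern_vec (const_mx p) x else 0).
  have p0 : 0 <= bern_vec (const_mx p) x.
    by apply: bern_vec_ge0 => i; rewrite mxE; case/andP: p01 => /ltW-> /ltW->.
  have e0 := expR_ge0 (rel_entropy_vec p y + r).
  have [_|hs] := ltP (s ^+ 2).
    by rewrite -addrA lerDl addr_ge0//; case: ifP; rewrite ?mulr_ge0.
  have [_|lr] := ltP (r ^+ 2).
    by rewrite add0r lerDl; case: ifP; rewrite ?mulr_ge0.
  have s0 : 0 <= s by rewrite mulr_ge0// sqrtr_ge0.
  have {}hs : `|h x| <= s by rewrite -ler_sqr ?nnegrE// real_normK ?num_real.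
  have {}lr : llr x <= r.
    rewrite (le_trans (ler_norm _))// -ler_sqr ?nnegrE//.
    by rewrite real_normK ?num_real.
  have -> : t <= f (bool_vec R x).
    by move: hs ty; rewrite ler_norml /h -/s; lra.
  (* For [y] on the boundary some vertices have mass 0; the density formula is used only on the
     others. *)
  rewrite !add0r; have [->|wx] := eqVneq (w x) 0; first by rewrite mulr_ge0.
  rewrite /w (bern_vec_change_of_measure p01) ?ler_wpM2l//=.
    by rewrite mulrC ler_wpM2r// ler_expR lerD2l.
  move=> i; rewrite lt_neqAle bern_ge0 ?cy// andbT eq_sym.
  by move/prodf_neq0: wx; exact.
have := ler_sum (index_enum _) (fun x (_ : xpredT x) => cover x).
rewrite W1 !big_split/=.
rewrite -!big_mkcond -mulr_sumr/= => H.
have {}H : 2^-1 <= expR (rel_entropy_vec p y + r) *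
    \sum_(x : {ffun 'I_n -> bool} | t <= f (bool_vec R x))
      bern_vec (const_mx p) x by lra.
rewrite -opprD expRN -[leLHS]mul1r ler_pdivrMr ?expR_gt0//.
by rewrite -mulrA mulrC -ler_pdivrMr// mul1r mulrC.
Qed.

End change_of_measure.

(** * Extension to the closed cube *)

Section one_variable.
Context {R : realType}.
Implicit Types (f df : R -> R) (r s t : R).

(** Serves twice: for sections of [f] through boundary points, where the Taylor estimate comes from
    a limit, and for the piecewise quadratic cutoff. *)
Lemma is_derive_quadratic f u v r d C : u < r < v ->
  (forall s, u <= s <= v -> `|f s - f r - (s - r) * d| <= C * (s - r) ^+ 2) ->
  is_derive r (1 : R) f d.
Proof.
move=> /andP[ur rv] H.
suff L : (fun h => h^-1 *: ((f \o shift r) (h *: (1 : R)) - f r)) @ 0^' --> d.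
  by apply: DeriveDef; [exact: cvgP L | exact: cvg_lim L].
apply/cvgrPdist_le => e e0.
pose k := Num.min (Num.min (r - u) (v - r)) (e / (`|C| + 1)).
have C1 : 0 < `|C| + 1 by rewrite ltr_wpDl.
have k0 : 0 < k by rewrite !lt_min !subr_gt0 ur rv divr_gt0.
near=> h.
have h0 : h != 0 by near: h; exact: nbhs_dnbhs_neq.
have hk : `|h| < k.
  near: h; apply: dnbhs0_lt => //.
move: hk; rewrite !lt_min => /andP[/andP[hr hr1] he].
have suv : u <= h + r <= v.
  move: hr hr1; rewrite !ltr_norml => /andP[? ?] /andP[? ?].
  by apply/andP; split; lra.
have := H _ suv; rewrite addrK => Hh.
have -> : d - h^-1 *: ((f \o shift r) (h *: (1 : R)) - f r) =
    - (h^-1 * (f (h + r) - f r - h * d)).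
  by rewrite /= /GRing.scale/= mulr1; field.
rewrite normrN normrM normfV ler_pdivrMl ?normr_gt0//.
apply: (le_trans Hh); rewrite -[h ^+ 2]real_normK ?num_real// expr2 mulrA.
apply: (@le_trans _ _ (`|h| * (`|C| * `|h|))).
  by rewrite mulrC ler_wpM2l// ler_wpM2r// ler_norm.
rewrite ler_wpM2l//; move: he; rewrite ltr_pdivlMr// => he.
apply: (le_trans _ (ltW he)); rewrite mulrDr mulr1 mulrC.
by rewrite lerDl.
Unshelve. all: by end_near. Qed.

Lemma open_unit_MVT f df :
  (forall r, 0 < r < 1 -> is_derive r (1 : R) f (df r)) ->
  forall s r, 0 < s < 1 -> 0 < r < 1 -> exists t,
    [/\ 0 < t < 1, `|t - r| <= `|s - r| & f s - f r = (s - r) * df t].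
Proof.
move=> fdf.
have main u v : 0 < u < 1 -> 0 < v < 1 -> u <= v ->
    exists2 t, u <= t <= v & f v - f u = (v - u) * df t.
  move=> /andP[u0 u1] /andP[v0 v1] uv; have [||t] := @MVT_segment _ f df _ _ uv.
  - move=> t; rewrite in_itv/= => /andP[ut tv]; apply: fdf.
    by rewrite (lt_trans u0)// (lt_trans tv).
  - apply: derivable_within_continuous => t; rewrite in_itv/= => /andP[ut tv].
    have : is_derive t (1 : R) f (df t).
      by apply: fdf; rewrite (lt_le_trans u0)// (le_lt_trans tv).
    by case.
  - by rewrite in_itv/= => utv E; exists t => //; rewrite E mulrC.
move=> s r s01 r01; case/andP: (s01) => s0 s1; case/andP: (r01) => r0 r1.
have [sr|/ltW rs] := leP s r.
  have [t /andP[st tr] E] := main _ _ s01 r01 sr; exists t; split.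
  - by rewrite (lt_le_trans s0)// (le_lt_trans tr).
  - by rewrite !ler0_norm ?subr_le0// lerN2 lerB.
  - by rewrite -opprB E -mulNr opprB.
have [t /andP[rt ts] E] := main _ _ r01 s01 rs; exists t; split => //.
- by rewrite (lt_le_trans r0)// (le_lt_trans ts).
- by rewrite !ger0_norm ?subr_ge0// lerB.
Qed.

Lemma lipschitz_within_continuous f b :
  (forall s r, 0 <= s <= 1 -> 0 <= r <= 1 -> `|f s - f r| <= b * `|s - r|) ->
  {within `[0, 1], continuous f}.
Proof.
move=> H; apply/subspace_continuousP => r; rewrite /= in_itv/= => r01.
apply/cvgrPdist_le => e e0; rewrite near_withinE.
have b1 : 0 < `|b| + 1 by rewrite ltr_wpDl.
near=> s; rewrite /= in_itv/= => s01.
apply: (le_trans (H _ _ r01 s01)).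
have : `|r - s| < e / (`|b| + 1).
  by near: s; apply: cvgr_dist_lt => //; rewrite divr_gt0.
rewrite ltr_pdivlMr// => he; apply: (le_trans _ (ltW he)).
by rewrite mulrDr mulr1 mulrC ler_wpDr// ler_wpM2l// ler_norm.
Unshelve. all: by end_near. Qed.

End one_variable.

Section cube_topology.
Context {R : realType} {n : nat}.
Implicit Types (f : 'rV[R]_n -> R) (x : 'rV[R]_n) (i j : 'I_n).

Lemma compact_cube : compact (cube : set 'rV[R]_n).
Proof.
have -> : cube = [set x : 'rV[R]_n | forall i, x ord0 i \in `[0, 1]].
  by apply/seteqP; split=> x cx i; have := cx i; rewrite /= in_itv.
exact: (@rV_compact R n (fun=> `[0, 1]%classic) (fun=> @segment_compact R 0 1)).
Qed.

Lemma supnorm_ge f x : {within cube, continuous f} -> cube x ->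
  `|f x| <= supnorm f.
Proof.
move=> fc cx; apply: ub_le_sup; last by exists x.
have /compact_bounded[M [Mr MP]] := continuous_compact fc compact_cube.
exists (M + 1) => _ [y cy <-]; apply: MP; first by rewrite ltrDl.
by exists y.
Qed.

Lemma supnorm_ge0 f : {within cube, continuous f} -> 0 <= supnorm f.
Proof. by move=> fc; exact: le_trans (normr_ge0 _) (supnorm_ge fc cube0). Qed.

(** The homothety towards the centre of the cube. It maps the closed cube into the open one for
    [0 < e <= 1], so estimates known inside reach the boundary as [e] tends to 0. *)
Definition shrink (e : R) x : 'rV[R]_n := x + e *: (const_mx 2^-1 - x).

Lemma shrinkE e x i : shrink e x 0 i = x 0 i + e * (2^-1 - x 0 i).
Proof. by rewrite !mxE. Qed.

Lemma shrink_upd e x i s :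
  shrink e (upd x i s) = upd (shrink e x) i (s + e * (2^-1 - s)).
Proof. by apply/rowP => j; rewrite !(shrinkE, updE); case: eqP. Qed.

Lemma shrink_itv (e s : R) : 0 < e <= 1 -> 0 <= s <= 1 ->
  0 < s + e * (2^-1 - s) < 1.
Proof. by move=> /andP[e0 e1] /andP[s0 s1]; apply/andP; split; nra. Qed.

Lemma open_cube_shrink e x : 0 < e <= 1 -> cube x -> open_cube (shrink e x).
Proof. by move=> e01 cx i; rewrite shrinkE shrink_itv. Qed.

Lemma open_cubeW x : open_cube x -> cube x.
Proof. by move=> cx i; case/andP: (cx i) => /ltW-> /ltW->. Qed.

Lemma harmonic01 k : 0 < (harmonic k : R) <= 1.
Proof. by rewrite /harmonic invr_gt0 ltr0n/= invf_le1 ?ltr0n// ler1n. Qed.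

Lemma cvg_shrink x : shrink (harmonic k) x @[k --> \oo] --> x.
Proof.
rewrite -[X in _ --> X]addr0; apply: cvgD; first exact: cvg_cst.
rewrite -(scale0r (const_mx 2^-1 - x)); apply: cvgZl.
exact: cvg_harmonic.
Qed.

Lemma cvg_within_shrink f x : {within cube, continuous f} -> cube x ->
  f (shrink (harmonic k) x) @[k --> \oo] --> f x.
Proof.
move=> /subspace_continuousP fc cx; have := fc _ cx.
apply: cvg_trans => U; rewrite /= => fU.
have H : \forall k \near \oo, cube (shrink (harmonic k) x) ->
  U (f (shrink (harmonic k) x)) := cvg_shrink (x := x) fU.
suff : \forall k \near \oo, U (f (shrink (harmonic k) x)) by [].
apply: filterS H => k; apply.
by apply/open_cubeW/open_cube_shrink => //; exact: harmonic01.
Qed.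

End cube_topology.

Lemma is_derive_upd (R : realType) n (f : 'rV[R]_n -> R) x i r d :
  derivable f (upd x i r) (delta_mx 0 i) -> partial i f (upd x i r) = d ->
  is_derive r (1 : R) (fun s => f (upd x i s)) d.
Proof.
move=> df fd.
have E : (fun h : R => h^-1 *: (((fun s => f (upd x i s)) \o shift r)
            (h *: (1 : R)) - f (upd x i r))) =
    (fun h : R => h^-1 *: ((f \o shift (upd x i r)) (h *: delta_mx 0 i)
            - f (upd x i r))).
  apply/funext => h /=; congr (_ *: (f _ - _)); apply/rowP => j.
  by rewrite !mxE/=; case: (j == i); rewrite //= mulr0 add0r.
by apply: DeriveDef; rewrite /derivable/= ?/derive E.
Qed.

Section C2_C11.
Context {R : realType} {n : nat}.
Implicit Types (x : 'rV[R]_n) (i j : 'I_n) (s r : R).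
Context {f : 'rV[R]_n -> R} {f1 : 'I_n -> 'rV[R]_n -> R}
  {f2 : 'I_n -> 'I_n -> 'rV[R]_n -> R}.
Hypothesis f_C2 : C2_on_cube f f1 f2.

Let b i := supnorm (f1 i).
Let c i j := supnorm (f2 i j).

Let fc : {within cube, continuous f}. Proof. by case: f_C2. Qed.
Let f1c i : {within cube, continuous (f1 i)}. Proof. by case: f_C2. Qed.
Let f2c i j : {within cube, continuous (f2 i j)}. Proof. by case: f_C2. Qed.

Let open_upd x i s : open_cube x -> 0 < s < 1 -> open_cube (upd x i s).
Proof. by move=> ox s01 j; rewrite updE; case: eqP. Qed.

Let derive_f x i r : open_cube x -> 0 < r < 1 ->
  is_derive r (1 : R) (fun s => f (upd x i s)) (f1 i (upd x i r)).
Proof.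
move=> ox r01; case: f_C2 => _ _ _ H _.
by have [D E] := H i _ (open_upd i ox r01); apply: is_derive_upd.
Qed.

Let open_lipschitz x i s r : open_cube x -> 0 < s < 1 -> 0 < r < 1 ->
  `|f (upd x i s) - f (upd x i r)| <= b i * `|s - r|.
Proof.
move=> ox s01 r01.
have [t [t01 _ ->]] := open_unit_MVT (fun r => derive_f i ox (r := r)) s01 r01.
rewrite normrM mulrC ler_wpM2r// supnorm_ge//.
exact/open_cubeW/open_upd.
Qed.

Let open_lipschitz1 x i j s r : open_cube x -> 0 < s < 1 -> 0 < r < 1 ->
  `|f1 j (upd x i s) - f1 j (upd x i r)| <= c i j * `|s - r|.
Proof.
move=> ox s01 r01; have [_ _ _ H1 H2] := f_C2.
have D (u : R) : 0 < u < 1 -> is_derive u (1 : R)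
    (fun v => partial j f (upd x i v)) (f2 i j (upd x i u)).
  move=> u01; have [D E] := H2 i j _ (open_upd i ox u01).
  exact: is_derive_upd.
have [_ <-] := H1 j _ (open_upd i ox s01).
have [_ <-] := H1 j _ (open_upd i ox r01).
have [t [t01 _ ->]] := open_unit_MVT D s01 r01.
rewrite normrM mulrC ler_wpM2r// supnorm_ge//.
exact/open_cubeW/open_upd.
Qed.

Let open_taylor x i s r : open_cube x -> 0 < s < 1 -> 0 < r < 1 ->
  `|f (upd x i s) - f (upd x i r) - (s - r) * f1 i (upd x i r)| <=
  c i i * (s - r) ^+ 2.
Proof.
move=> ox s01 r01.
have [t [t01 tr ->]] := open_unit_MVT (fun r => derive_f i ox (r := r)) s01 r01.
rewrite -mulrBr normrM -[(s - r) ^+ 2]real_normK ?num_real// expr2 mulrCA.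
rewrite ler_wpM2l//; apply: (le_trans (open_lipschitz1 _ _ ox t01 r01)).
by rewrite ler_wpM2l// supnorm_ge0.
Qed.

Let cvg_shrink_upd (h : 'rV[R]_n -> R) x i s : {within cube, continuous h} ->
  cube x -> 0 <= s <= 1 ->
  h (upd (shrink (harmonic k) x) i (s + harmonic k * (2^-1 - s)))
    @[k --> \oo] --> h (upd x i s).
Proof.
move=> hc cx s01; have := cvg_within_shrink hc (cube_upd i cx s01).
by under eq_fun do rewrite shrink_upd.
Qed.

Let shrink_sub (e s r : R) :
  s + e * (2^-1 - s) - (r + e * (2^-1 - r)) = (1 - e) * (s - r).
Proof. ring. Qed.

Let shrink_sub_le k (s r : R) : `|(1 - harmonic k) * (s - r)| <= `|s - r|.
Proof.
rewrite normrM ler_piMl// ler_norml; have := harmonic01 (R := R) k.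
by case/andP => h0 h1; apply/andP; split; lra.
Qed.

(** The interior estimate holds at the shrunk points, where [|s - r|] has only decreased, and
    continuity passes it to the limit. *)
Lemma C2_lipschitz x i s r : cube x -> 0 <= s <= 1 -> 0 <= r <= 1 ->
  `|f (upd x i s) - f (upd x i r)| <= b i * `|s - r|.
Proof.
move=> cx s01 r01.
apply: (cvgr_to_le (cvg_norm (cvgB (@cvg_shrink_upd f x i s fc cx s01)
  (@cvg_shrink_upd f x i r fc cx r01)))).
near=> k; have h01 := harmonic01 (R := R) k.
apply: (le_trans (open_lipschitz _ (open_cube_shrink h01 cx) _ _)).
- exact: shrink_itv.
- exact: shrink_itv.
- by rewrite shrink_sub ler_wpM2l ?supnorm_ge0.
Unshelve. all: by end_near. Qed.

Lemma C2_gradient_lipschitz x i j s r :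
  cube x -> 0 <= s <= 1 -> 0 <= r <= 1 ->
  `|f1 j (upd x i s) - f1 j (upd x i r)| <= c i j * `|s - r|.
Proof.
move=> cx s01 r01.
have Hs := @cvg_shrink_upd (f1 j) x i s (@f1c j) cx s01.
have Hr := @cvg_shrink_upd (f1 j) x i r (@f1c j) cx r01.
apply: (cvgr_to_le (cvg_norm (cvgB Hs Hr))).
near=> k; have h01 := harmonic01 (R := R) k.
apply: (le_trans (open_lipschitz1 _ _ (open_cube_shrink h01 cx) _ _)).
- exact: shrink_itv.
- exact: shrink_itv.
- by rewrite shrink_sub ler_wpM2l ?supnorm_ge0.
Unshelve. all: by end_near. Qed.

(** This form of differentiability involves only values of [f] and [f1], so it survives the limit to
    faces of the cube, where no derivative is given. *)
Lemma C2_taylor x i s r : cube x -> 0 <= s <= 1 -> 0 <= r <= 1 ->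
  `|f (upd x i s) - f (upd x i r) - (s - r) * f1 i (upd x i r)| <=
  c i i * (s - r) ^+ 2.
Proof.
move=> cx s01 r01.
have sr : (1 - harmonic k) * (s - r) @[k --> \oo] --> s - r.
  have : (1 - harmonic k) * (s - r) @[k --> \oo] --> (1 - 0) * (s - r).
    apply: cvgMl; apply: cvgB; first exact: cvg_cst.
    exact: cvg_harmonic.
  by rewrite subr0 mul1r.
have Hs := @cvg_shrink_upd f x i s fc cx s01.
have Hr := @cvg_shrink_upd f x i r fc cx r01.
have H1 := @cvg_shrink_upd (f1 i) x i r (@f1c i) cx r01.
apply: (cvgr_to_le (cvg_norm (cvgB (cvgB Hs Hr) (cvgM sr H1)))).
near=> k; have h01 := harmonic01 (R := R) k.
have := open_taylor i (open_cube_shrink h01 cx) (shrink_itv h01 s01)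
  (shrink_itv h01 r01).
rewrite shrink_sub => /le_trans; apply.
rewrite ler_wpM2l ?supnorm_ge0//.
rewrite -[leLHS]real_normK ?num_real// -[leRHS]real_normK ?num_real//.
by rewrite ler_sqr ?nnegrE// shrink_sub_le.
Unshelve. all: by end_near. Qed.

Lemma C2_C11 : C11_on_cube f f1 b c.
Proof.
split.
- move=> x i r cx r01; apply: (is_derive_quadratic (C := c i i) r01) => s s01.
  apply: C2_taylor => //.
  by case/andP: r01 => /ltW-> /ltW->.
- move=> x i cx; apply: lipschitz_within_continuous => s r s01 r01.
  exact: C2_lipschitz.
- by move=> x i cx; exact: supnorm_ge.
- move=> x i j s cx s01; rewrite -[in f1 j x](upd_id x i).
  exact: C2_gradient_lipschitz.
- by move=> i j; exact: supnorm_ge0.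
Qed.

End C2_C11.

(** Product rule on increments: the change of [f1 j] gives [k1 * c i j], and that of [dpsi (f x)],
    with [f] varying at rate [b i], gives [k2 * b i * b j]. *)
Lemma C11_comp (R : realType) n (f : 'rV[R]_n -> R) f1 b c
    (psi dpsi : R -> R) (k1 k2 : R) :
  C11_on_cube f f1 b c ->
  (forall u, is_derive u (1 : R) psi (dpsi u)) ->
  (forall u, `|dpsi u| <= k1) ->
  (forall u v, `|dpsi u - dpsi v| <= k2 * `|u - v|) ->
  C11_on_cube (psi \o f) (fun i x => dpsi (f x) * f1 i x)
    (fun i => k1 * b i) (fun i j => k1 * c i j + k2 * b i * b j).
Proof.
move=> fC11 dP H1 H2.
have k10 : 0 <= k1 by exact: le_trans (normr_ge0 _) (H1 0).
have k20 : 0 <= k2.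
  have := H2 1 0; rewrite subr0 normr1 mulr1; exact: le_trans.
have b0 := C11_b_ge0 fC11; have c0 := C11_c_ge0 fC11.
split.
- move=> x i r cx r01.
  apply: (@is_derive1_comp _ psi (fun s => f (upd x i s)) r _ _ _) => //.
  exact: (C11_derive fC11).
- move=> x i cx s.
  apply: (@continuous_comp (subspace (`[0, 1]%classic : set R)) R R
    (fun s => f (upd x i s)) psi s).
    exact: (@C11_continuous _ _ _ _ _ _ fC11 x i cx).
  apply/differentiable_continuous/derivable1_diffP.
  by have [] := dP (f (upd x i s)).
- by move=> x i cx; rewrite normrM ler_pM// (C11_bound fC11).
- move=> x i j s cx s01.
  set u := f _; set v := f _; set p := f1 _ _; set q := f1 _ _.
  have -> : dpsi u * p - dpsi v * q = dpsi u * (p - q) + (dpsi u - dpsi v) * q.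
    by ring.
  apply: (le_trans (ler_normD _ _)); rewrite !normrM mulrDl; apply: lerD.
    by rewrite -mulrA ler_pM// (C11_lipschitz fC11).
  have uv : `|u - v| <= b i * `|s - x 0 i|.
    apply: (le_trans (C11_value_lipschitz fC11 (cube_upd i cx s01) cx)).
    rewrite (bigD1 i)//= big1 ?addr0 => [|k ki]; first by rewrite updE eqxx.
    by rewrite updE (negbTE ki) subrr normr0 mulr0.
  have -> : k2 * b i * b j * `|s - x 0 i| = k2 * (b i * `|s - x 0 i|) * b j.
    by ring.
  rewrite ler_pM// ?(C11_bound fC11)//; apply: (le_trans (H2 _ _)).
  by rewrite ler_wpM2l.
- by move=> i j; rewrite addr_ge0 ?mulr_ge0.
Qed.

(** * The upper tail *)

Section smooth_step.
Context {R : realType}.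
Implicit Types u v : R.

(* A [C^1] step equal to [-1] on ]-oo, -1] and to [0] on [0, +oo[, with
   derivative the tent of height 2 on [-1, 0]. *)
Definition step u : R :=
  2 * (Num.max (u + 1) 0 ^+ 2 - 2 * Num.max (u + 2^-1) 0 ^+ 2
       + Num.max u 0 ^+ 2) - 1.

Definition dstep u : R :=
  4 * (Num.max (u + 1) 0 - 2 * Num.max (u + 2^-1) 0 + Num.max u 0).

Lemma max0_sqr_taylor u v :
  `|Num.max v 0 ^+ 2 - Num.max u 0 ^+ 2 - (v - u) * (2 * Num.max u 0)|
  <= (v - u) ^+ 2.
Proof.
have sq := sqr_ge0 (v - u); have su := sqr_ge0 u; have sv := sqr_ge0 v.
rewrite ler_norml; have [v0|/ltW v0] := leP v 0; have [u0|/ltW u0] := leP u 0.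
- by rewrite !(subr0, mulr0, expr0n)/= oppr_le0 sq.
- have := mulr_ge0 u0 (_ : 0 <= - v); rewrite oppr_ge0 => /(_ v0).
  by rewrite expr0n/= => ?; apply/andP; split; lra.
- have := mulr_ge0 v0 (_ : 0 <= - u); rewrite oppr_ge0 => /(_ u0).
  by rewrite expr0n/= => ?; apply/andP; split; lra.
- by apply/andP; split; lra.
Qed.

(** The constant is [2 * (1 + 2 + 1)], from the coefficients of the three squares in [step]. *)
Lemma step_taylor u v :
  `|step v - step u - (v - u) * dstep u| <= 8 * (v - u) ^+ 2.
Proof.
have H1 := max0_sqr_taylor (u + 1) (v + 1).
have H2 := max0_sqr_taylor (u + 2^-1) (v + 2^-1).
have H3 := max0_sqr_taylor u v.
rewrite (_ : v + 1 - (u + 1) = v - u) in H1; last by ring.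
rewrite (_ : v + 2^-1 - (u + 2^-1) = v - u) in H2; last by ring.
move: H1 H2 H3; rewrite /step /dstep.
move: (Num.max (u + 1) 0) (Num.max (v + 1) 0) => a a'.
move: (Num.max (u + 2^-1) 0) (Num.max (v + 2^-1) 0) => b b'.
move: (Num.max u 0) (Num.max v 0) => c c'.
rewrite !ler_norml => /andP[? ?] /andP[? ?] /andP[? ?].
by apply/andP; split; lra.
Qed.

Lemma step_ge0 u : 0 <= u -> step u = 0.
Proof.
move=> u0; rewrite /step !max_l//; first by field.
- by rewrite addr_ge0.
- by rewrite addr_ge0.
Qed.

Lemma step_leN1 u : u <= -1 -> step u = -1.
Proof.
move=> u1; rewrite /step !max_r; [by ring | lra..].
Qed.

Lemma step_itv u : -1 <= step u <= 0.
Proof.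
have [u0|u0] := leP 0 u; first by rewrite step_ge0// lexx lerN10.
have [u1|u1] := leP u (-1); first by rewrite step_leN1// lexx lerN10.
rewrite /step [Num.max (u + 1) 0]max_l; last lra.
rewrite [Num.max u 0]max_r; last by rewrite ltW.
by have [h|h] := leP (u + 2^-1) 0; apply/andP; split; nra.
Qed.

Lemma dstep_itv u : 0 <= dstep u <= 2.
Proof.
rewrite /dstep; have [u0|u0] := leP u 0; have [u1|u1] := leP (u + 1) 0;
  have [u2|u2] := leP (u + 2^-1) 0; apply/andP; split; lra.
Qed.

Lemma dstep_lipschitz u v : `|dstep u - dstep v| <= 4 * `|u - v|.
Proof.
wlog uv : u v / v <= u.
  move=> H; have [/H//|/ltW/H] := leP v u.
  by rewrite distrC [X in _ <= 4 * X -> _]distrC.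
rewrite [ `|u - v| ]ger0_norm ?subr_ge0// ler_norml /dstep.
have [u0|u0] := leP u 0; have [u1|u1] := leP (u + 1) 0;
have [u2|u2] := leP (u + 2^-1) 0; have [v0|v0] := leP v 0;
have [v1|v1] := leP (v + 1) 0; have [v2|v2] := leP (v + 2^-1) 0;
by apply/andP; split; lra.
Qed.

End smooth_step.

(** * Relative entropy and the rate function *)

Section rate_function.
Context {R : realType}.
Implicit Types (p u t s : R).

(** This is [1 + z <= expR z] at [z = ln (p / u)]; adding the versions for [u] and [1 - u] makes the
    relative entropy nonnegative. *)
Lemma mul_ln_ratio_ge u p : 0 <= u -> 0 < p -> u - p <= u * ln (u / p).
Proof.
move=> u0 p0; have [->|un0] := eqVneq u 0.
  by rewrite mul0r sub0r oppr_le0 ltW.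
have {un0}u0 : 0 < u by rewrite lt_neqAle eq_sym un0.
rewrite -[u / p]invf_div lnV ?posrE ?divr_gt0// mulrN lerNr.
have := ler_wpM2l (ltW u0) (expR_ge1Dx (ln (p / u))).
rewrite lnK ?posrE ?divr_gt0// mulrCA mulfV ?gt_eqF// mulr1; lra.
Qed.

Lemma rel_entropy_ge0 p u : 0 < p < 1 -> 0 <= u <= 1 -> 0 <= rel_entropy p u.
Proof.
move=> /andP[p0 p1] /andP[u0 u1]; rewrite /rel_entropy.
have := mul_ln_ratio_ge u0 p0.
have : (1 - u) - (1 - p) <= (1 - u) * ln ((1 - u) / (1 - p)).
  by apply: mul_ln_ratio_ge; rewrite ?subr_ge0 ?subr_gt0.
lra.
Qed.

Context {n : nat} (f : 'rV[R]_n -> R) (p : R).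
Hypothesis p01 : 0 < p < 1.

Lemma rel_entropy_vec_ge0 (x : 'rV[R]_n) : cube x -> 0 <= rel_entropy_vec p x.
Proof. by move=> cx; apply: sumr_ge0 => i _; exact: rel_entropy_ge0. Qed.

Lemma phi_le t x : cube x -> t * n%:R <= f x ->
  (phi p f t <= (rel_entropy_vec p x)%:E)%E.
Proof. by move=> cx tx; apply: ereal_inf_lbound; exists x. Qed.

Lemma phi_ge0 t : (0 <= phi p f t)%E.
Proof.
apply: le_ereal_inf_tmp => _ [x [cx _] <-].
by rewrite lee_fin rel_entropy_vec_ge0.
Qed.

Lemma le_phi s t : s <= t -> (phi p f s <= phi p f t)%E.
Proof.
move=> st; apply: le_ereal_inf_tmp => _ [x [cx tx] <-]; apply: phi_le => //.
by apply: le_trans tx; rewrite ler_wpM2r.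
Qed.

Lemma phi_fin_num t x : cube x -> t * n%:R <= f x -> phi p f t \is a fin_num.
Proof.
move=> cx tx; rewrite ge0_fin_numE ?phi_ge0//.
exact: le_lt_trans (phi_le cx tx) (ltry _).
Qed.

Lemma phi_infeasible t : (forall x, cube x -> f x < t * n%:R) ->
  phi p f t = +oo%E.
Proof.
move=> H; rewrite /phi; set S := (X in ereal_inf X).
suff -> : S = set0 by rewrite ereal_inf0.
apply/seteqP; split=> // z [x [cx tx] _]; have := H x cx.
by rewrite ltNge tx.
Qed.

End rate_function.

Lemma sum_norm_sqr_le (R : realType) (n : nat) (u : 'I_n -> R) :
  (\sum_i `|u i|) ^+ 2 <= n%:R * \sum_i u i ^+ 2.
Proof.
have : 2 * (\sum_i `|u i|) ^+ 2 <= 2 * (n%:R * \sum_i u i ^+ 2).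
  have -> : 2 * (n%:R * \sum_i u i ^+ 2) =
      \sum_(i < n) \sum_(j < n) (u i ^+ 2 + u j ^+ 2).
    rewrite [RHS](eq_bigr (fun i => n%:R * u i ^+ 2 + \sum_j u j ^+ 2)).
      rewrite big_split/= -mulr_sumr sumr_const card_ord.
      by rewrite -[(\sum_i _) *+ n]mulr_natl; ring.
    by move=> i _; rewrite big_split/= sumr_const card_ord mulr_natl.
  rewrite expr2 mulr_suml mulr_sumr; apply: ler_sum => i _.
  rewrite !mulr_sumr; apply: ler_sum => j _.
  rewrite -[u i ^+ 2]real_normK ?num_real// -[u j ^+ 2]real_normK ?num_real//.
  have := sqr_ge0 (`|u i| - `|u j|); nra.
by rewrite ler_pM2l.
Qed.

(** * The smooth cutoff, the net of its gradients, and the upper tail of the vertex sum *)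

Section upper_tail.
Context {R : realType} {n : nat}.
Context {f : 'rV[R]_n -> R} {f1 : 'I_n -> 'rV[R]_n -> R}
  {b : 'I_n -> R} {c : 'I_n -> 'I_n -> R}.
Hypothesis n_gt0 : (0 < n)%N.
Hypothesis fC11 : C11_on_cube f f1 b c.
Variables (D : R -> {fset 'rV[R]_n}) (p K delta eps t : R).
Hypothesis D_net : gradient_net f1 D.
Hypothesis p01 : 0 < p < 1.
Hypothesis K_gt0 : 0 < K.
Hypothesis delta_gt0 : 0 < delta.
Hypothesis eps_gt0 : 0 < eps.

Let n0 : 0 < n%:R :> R. Proof. by rewrite ltr0n. Qed.

Let psi (v : R) := n%:R * K * step ((v / n%:R - t) / delta).
Let dpsi (v : R) := K / delta * dstep ((v / n%:R - t) / delta).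
Let slope := 2 * K / delta.
Let curv := 6 * K / (n%:R * delta ^+ 2).
Let B := Num.sqrt (n%:R^-1 * \sum_(i < n) b i ^+ 2).

Let arg_sub u v : (v / n%:R - t) / delta - (u / n%:R - t) / delta =
  (v - u) / (n%:R * delta).
Proof. by field; rewrite !gt_eqF. Qed.

Let psi_derive u : is_derive u (1 : R) psi (dpsi u).
Proof.
apply: (@is_derive_quadratic _ psi (u - 1) (u + 1) _ _
  (n%:R * K * (8 / (n%:R * delta) ^+ 2))).
  by apply/andP; split; lra.
move=> v _; have := step_taylor ((u / n%:R - t) / delta)
  ((v / n%:R - t) / delta).
rewrite arg_sub => /(ler_wpM2l (mulr_ge0 (ltW n0) (ltW K_gt0))) H.
rewrite [leLHS](_ : _ = n%:R * K *
    `|step ((v / n%:R - t) / delta) - step ((u / n%:R - t) / delta)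
     - (v - u) / (n%:R * delta) * dstep ((u / n%:R - t) / delta)|).
  apply: (le_trans H); rewrite le_eqVlt; apply/orP; left; apply/eqP.
  by field; rewrite !gt_eqF.
rewrite -[in RHS](@ger0_norm _ (n%:R * K)) ?mulr_ge0 ?ltW// -normrM.
congr `|_|; rewrite /psi /dpsi; field.
by rewrite !gt_eqF.
Qed.

Let dpsi_itv u : 0 <= dpsi u <= slope.
Proof.
have /andP[d0 d2] := dstep_itv ((u / n%:R - t) / delta).
have k0 : 0 <= K / delta by rewrite divr_ge0 ?ltW.
rewrite /dpsi mulr_ge0//= (_ : slope = K / delta * 2) ?ler_wpM2l//.
by rewrite /slope; ring.
Qed.

(** The slope 4 of the tent gives [4 K / (n delta^2)], which is at most [curv]. *)
Let dpsi_lipschitz u v : `|dpsi u - dpsi v| <= curv * `|u - v|.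
Proof.
have k0 : 0 <= K / delta by rewrite divr_ge0 ?ltW.
have nd0 : 0 <= (n%:R * delta)^-1 by rewrite invr_ge0 mulr_ge0 ?ltW.
rewrite /dpsi -mulrBr normrM (ger0_norm k0).
have := dstep_lipschitz ((u / n%:R - t) / delta) ((v / n%:R - t) / delta).
rewrite arg_sub normrM (ger0_norm nd0) => H.
apply: (le_trans (ler_wpM2l k0 H)).
have -> : K / delta * (4 * (`|u - v| / (n%:R * delta))) =
    4 * (K / (n%:R * delta ^+ 2) * `|u - v|) by field; rewrite !gt_eqF.
have k1 : 0 <= K / (n%:R * delta ^+ 2) * `|u - v|.
  by rewrite mulr_ge0// divr_ge0 ?mulr_ge0 ?sqr_ge0 ?ltW.
by rewrite /curv -!mulrA in k1 *; lra.
Qed.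

Let b0 : forall i, 0 <= b i := C11_b_ge0 fC11.
Let c0 : forall i j, 0 <= c i j := C11_c_ge0 fC11.

Let gC11 : C11_on_cube (psi \o f) (fun i x => dpsi (f x) * f1 i x)
  (beta p K delta b) (gamma K delta b c).
Proof.
have dpsi_le u : `|dpsi u| <= slope.
  by have /andP[d0 d1] := dpsi_itv u; rewrite ger0_norm.
apply: (C11_weaken (C11_comp fC11 psi_derive dpsi_le dpsi_lipschitz)).
  move=> i; rewrite /beta -addrA -[leLHS]addr0 lerD//.
  by rewrite le_eqVlt /slope; apply/orP; left; apply/eqP; ring.
move=> i j; rewrite /gamma /slope /curv le_eqVlt; apply/orP; left; apply/eqP.
by field; rewrite !gt_eqF.
Qed.

Let psi_itv u : - (n%:R * K) <= psi u <= 0.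
Proof.
have nK0 : 0 <= n%:R * K by rewrite mulr_ge0 ?ltW.
have /andP[s1 s0] := step_itv ((u / n%:R - t) / delta).
rewrite /psi; move: (step _) s1 s0 => z s1 s0.
by apply/andP; split; nra.
Qed.

Let psi_le (y : 'rV[R]_n) : cube y -> `|(psi \o f) y| <= @alpha R n p K.
Proof.
move=> _; change (`|psi (f y)| <= @alpha R n p K).
move: (psi (f y)) (psi_itv (f y)) => z /andP[z1 z0].
rewrite (ler0_norm z0) /alpha -addrA -[leLHS]addr0 lerD ?addr_ge0 ?mulr_ge0//.
by rewrite lerNl.
Qed.

Let q := K * B / (delta * eps).
(* The grid of slopes degenerates to [{0}] when [B = 0], as then [x / B = 0]. *)
Let theta_of (j : nat) := 2 * eps * j%:R / B.

Let q0 : 0 <= q.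
Proof. by rewrite divr_ge0 ?mulr_ge0 ?sqrtr_ge0 ?ltW. Qed.

(** The slope is rounded down to a multiple of [2 eps / B]. As slopes are at most [2 K / delta], the
    index is at most [q]. *)
Let discretize u : exists2 j, (j < (Num.truncn q).+1)%N &
  [/\ 0 <= theta_of j, theta_of j <= dpsi u
    & (dpsi u - theta_of j) * B <= 2 * eps].
Proof.
have /andP[d0 d1] := dpsi_itv u.
pose w := dpsi u * B / (2 * eps); exists (Num.truncn w).
  rewrite ltnS le_truncn// /w /q.
  have -> : K * B / (delta * eps) = slope * (B / (2 * eps)).
    by rewrite /slope; field; rewrite !gt_eqF.
  by rewrite -mulrA ler_wpM2r// divr_ge0 ?sqrtr_ge0 ?mulr_ge0 ?ltW.
have e2 : 0 < 2 * eps by rewrite mulr_gt0.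
have w0 : 0 <= w by rewrite divr_ge0 ?(ltW e2)// mulr_ge0 ?sqrtr_ge0.
have th0 : 0 <= theta_of (Num.truncn w).
  by rewrite divr_ge0 ?sqrtr_ge0// !mulr_ge0 ?ler0n// ltW.
have [B0|Bn0] := eqVneq B 0.
  by split => //; rewrite /theta_of B0 ?invr0 !mulr0// ltW.
have Bp : 0 < B by rewrite lt_neqAle eq_sym Bn0 sqrtr_ge0.
have /andP[w1 w2] := truncn_itv w0.
split => //.
  rewrite /theta_of ler_pdivrMr// mulrC -ler_pdivlMr//.
move: (Num.truncn w) w2 => j; rewrite /w ltr_pdivrMr// -natr1 => w2.
by rewrite mulrBl /theta_of divfK ?gt_eqF//; lra.
Qed.

(** The net is the product of the slope grid and [D]. Rounding the slope costs [2 eps / B] times the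
    sum of the [b i], at most [2 n eps]; replacing the gradient costs at most [2 K / delta] times
    [n delta eps / (4 K)], below [n eps]. *)
Let net_point (x : {ffun 'I_n -> bool}) :
  exists k : 'I_(Num.truncn q).+1 * D (delta * eps / (4 * K)),
  \sum_i `|dpsi (f (bool_vec R x)) * f1 i (bool_vec R x)
           - (theta_of k.1 *: val k.2) 0 i| <= 3 * n%:R * eps.
Proof.
set y := bool_vec R x; set eta := delta * eps / (4 * K).
have eta0 : 0 < eta by rewrite divr_gt0 ?mulr_gt0.
have y01 i : y 0 i = 0 \/ y 0 i = 1.
  by rewrite /y bool_vecE; case: (x i); [right|left].
have [d dD dy] := D_net eta0 y01.
have [j jN [th0 th1 th2]] := discretize (f y).
exists (Ordinal jN, [` dD]%fset) => /=; set th := theta_of j in th0 th1 th2 *.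
have /andP[d0 d1] := dpsi_itv (f y).
apply: (@le_trans _ _ ((dpsi (f y) - th) * \sum_i b i
    + th * \sum_i `|f1 i y - d 0 i|)).
  rewrite !mulr_sumr -big_split/=; apply: ler_sum => i _; rewrite mxE.
  have -> : dpsi (f y) * f1 i y - th * d 0 i =
    (dpsi (f y) - th) * f1 i y + th * (f1 i y - d 0 i) by ring.
  apply: (le_trans (ler_normD _ _)).
  rewrite (normrM (_ - th)) (normrM th) (ger0_norm th0).
  rewrite [ `|_ - th| ]ger0_norm ?subr_ge0// lerD2r ler_wpM2l ?subr_ge0//.
  exact/(C11_bound fC11)/cube_bool_vec.
have sb : \sum_i b i <= n%:R * B.
  rewrite -ler_sqr ?nnegrE ?sumr_ge0 ?mulr_ge0 ?sqrtr_ge0 ?ler0n//.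
  rewrite exprMn sqr_sqrtr ?mulr_ge0 ?invr_ge0 ?ler0n ?sumr_ge0//; last first.
    by move=> i _; exact: sqr_ge0.
  rewrite expr2 -mulrA mulVKf ?gt_eqF//.
  have := sum_norm_sqr_le b.
  by rewrite (eq_bigr b) ?expr2// => i _; rewrite ger0_norm.
have sd : \sum_i `|f1 i y - d 0 i| <= n%:R * eta.
  have ne0 : 0 <= n%:R * eta := mulr_ge0 (ltW n0) (ltW eta0).
  rewrite -ler_sqr ?nnegrE ?ne0 ?sumr_ge0//.
  apply: (le_trans (sum_norm_sqr_le _)).
  by rewrite exprMn expr2 -mulrA ler_wpM2l ?ler0n.
have h1 : (dpsi (f y) - th) * \sum_i b i <= n%:R * (2 * eps).
  have : (dpsi (f y) - th) * \sum_i b i <= (dpsi (f y) - th) * (n%:R * B).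
    by rewrite ler_wpM2l ?subr_ge0.
  by move/le_trans; apply; rewrite mulrCA ler_wpM2l ?ler0n.
have h2 : th * \sum_i `|f1 i y - d 0 i| <= n%:R * eps.
  apply: (@le_trans _ _ (slope * (n%:R * eta))).
    apply: ler_pM th0 _ (le_trans th1 d1) sd.
    by apply: sumr_ge0 => i _; exact: normr_ge0.
  have -> : slope * (n%:R * eta) = n%:R * (eps / 2).
    by rewrite /slope /eta; field; rewrite !gt_eqF.
  by rewrite ler_wpM2l ?ler0n//; have := eps_gt0; lra.
apply: (le_trans (lerD h1 h2)); rewrite le_eqVlt; apply/orP; left; apply/eqP.
ring.
Qed.

(** The grid is a single point when [q < 1]; otherwise it has at most [q + 1 <= 4 q] points. *)
Let grid_card : ((Num.truncn q).+1)%:R <=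
  Num.max 1 (4 * K * B / (delta * eps)) :> R.
Proof.
have -> : 4 * K * B / (delta * eps) = 4 * q by rewrite /q; ring.
have /andP[q1 q2] := truncn_itv q0; rewrite le_max.
have [ql|ql] := ltP q 1.
  suff -> : Num.truncn q = 0%N by rewrite lexx.
  by apply/eqP; rewrite -leqn0 -ltnS -(ltr_nat R) (le_lt_trans q1).
by apply/orP; right; rewrite -natr1; lra.
Qed.

Lemma upper_tail_bound (m : R) :
  (forall y, cube y -> (t - delta) * n%:R <= f y -> m <= rel_entropy_vec p y) ->
  m <= n%:R * K ->
  let P := \sum_(x : {ffun 'I_n -> bool} | t * n%:R <= f (bool_vec R x))
             bern_vec (const_mx p) x in
  0 < P ->
  ln P <= - m + complexity_term p K delta b D eps
          + smoothness_term p K delta b c.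
Proof.
move=> m_inf mK P P0.
(* Where [f y >= (t - delta) n], the cutoff is nonpositive and the entropy is at least [m].
   Elsewhere the cutoff is [- n K], at most [- m], and the entropy is nonnegative. *)
have gM (y : 'rV[R]_n) : cube y -> (psi \o f) y - rel_entropy_vec p y <= - m.
  move=> cy; change (psi (f y) - rel_entropy_vec p y <= - m).
  have [fy|fy] := leP ((t - delta) * n%:R) (f y).
    move: (psi (f y)) (psi_itv (f y)) (m_inf y cy fy) => z /andP[_ z0] ?.
    by move: z0; lra.
  have -> : psi (f y) = - (n%:R * K).
    rewrite /psi step_leN1 ?mulrN1// ler_pdivrMr// mulN1r lerBlDr.
    by rewrite ler_pdivrMr// addrC ltW.
  have := rel_entropy_vec_ge0 p01 cy; lra.
have := mean_field_upper_bound gC11 psi_le p01 gM net_point.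
rewrite card_prod card_ord -cardfE natrM.
set L := Num.sqrt (mean_field_error _ _ _); set G := \sum_i gamma _ _ _ _ i i.
set E := expR _; set N := (Num.truncn q).+1%:R; set C := (#|` _ |)%:R => H.
have PH : P <= 2 * N * C * E.
  rewrite -(mulrA 2); apply: le_trans H.
  rewrite [leRHS](bigID (fun x : {ffun 'I_n -> bool} =>
    t * n%:R <= f (bool_vec R x))).
  rewrite -[leLHS]addr0 lerD//.
    apply: ler_sum => x fx; rewrite -[(psi \o f) _]/(psi (f _)).
    rewrite /psi step_ge0 ?mulr0 ?expR0 ?mulr1//.
    by rewrite divr_ge0 ?(ltW delta_gt0)// subr_ge0 ler_pdivlMr.
  apply: sumr_ge0 => x _; rewrite mulr_ge0 ?expR_ge0// bern_vec_ge0// => i.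
  by rewrite mxE; case/andP: p01 => /ltW-> /ltW->.
have N0 : 0 < N by rewrite ltr0n.
(* An empty net would give [P <= 0]. *)
have C0 : 0 < C.
  rewrite lt_neqAle ler0n andbT eq_sym; apply: contraTneq P0 => C0.
  by rewrite -leNgt (le_trans PH)// C0 mulr0 mul0r.
have : ln P <= ln (2 * N * C * E) by rewrite ler_ln ?posrE ?mulr_gt0 ?expR_gt0.
rewrite !lnM ?posrE ?mulr_gt0 ?expR_gt0// expRK => lnP.
have lnN : ln N <= ln (Num.max 1 (4 * K * B / (delta * eps))).
  by rewrite ler_ln ?posrE// (lt_le_trans N0).
have s1 :
    0 <= 4^-1 * Num.sqrt (n%:R * \sum_(i < n) beta p K delta b i ^+ 2) * eps.
  by rewrite !mulr_ge0 ?sqrtr_ge0 ?ltW.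
have s2 : 0 <= 4^-1 * Num.sqrt (\sum_(i < n) beta p K delta b i ^+ 2)
         * Num.sqrt (\sum_(i < n) gamma K delta b c i i ^+ 2).
  by rewrite !mulr_ge0 ?sqrtr_ge0.
have G0 : 0 <= G by apply: sumr_ge0 => i _; exact: (C11_c_ge0 gC11).
rewrite /complexity_term /smoothness_term -/B -/C -/G.
by move: lnP lnN s1 s2 G0; rewrite /L /mean_field_error; lra.
Qed.

End upper_tail.

(** * Nonnegativity of the error terms *)

Section error_terms.
Context {R : realType} {n : nat}.
Variables (p K delta : R) (b : 'I_n -> R) (c : 'I_n -> 'I_n -> R).
Hypothesis K0 : 0 <= K.
Hypothesis delta0 : 0 <= delta.
Hypothesis b0 : forall i, 0 <= b i.
Hypothesis c0 : forall i j, 0 <= c i j.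

Lemma complexity_term_ge0 (D : R -> {fset 'rV[R]_n}) eps : 0 <= eps ->
  0 <= complexity_term p K delta b D eps.
Proof.
move=> e0; rewrite /complexity_term !addr_ge0 ?mulr_ge0 ?sqrtr_ge0//.
  by rewrite ln_ge0// le_max lexx.
(* The set may be empty, in which case [ln 0 = 0]. *)
have [->|C0] := eqVneq #|` D (delta * eps / (4 * K))| 0%N; first by rewrite ln0.
by rewrite ln_ge0// ler1n lt0n.
Qed.

Lemma smoothness_term_ge0 : 0 <= smoothness_term p K delta b c.
Proof.
rewrite /smoothness_term !addr_ge0 ?mulr_ge0 ?sqrtr_ge0//; last first.
  by rewrite ln_ge0// ler1n.
apply: sumr_ge0 => i _; by rewrite /gamma addr_ge0 ?divr_ge0 ?mulr_ge0.
Qed.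

End error_terms.

(** * Both tail bounds for the random vector *)

Theorem theorem1p1 (R : realType) (n : nat) (n_gt0 : (0 < n)%N)
    (f : 'rV[R]_n -> R) (f1 : 'I_n -> 'rV[R]_n -> R)
    (f2 : 'I_n -> 'I_n -> 'rV[R]_n -> R) (f_C2 : C2_on_cube f f1 f2)
    (D : R -> {fset 'rV[R]_n}) (D_net : gradient_net f1 D)
    (p : R) (p01 : 0 < p < 1)
    (d : measure_display) (T : measurableType d) (P : probability T R)
    (Y : 'I_n -> {RV P >-> bool})
    (Y_bernoulli : forall i, distribution P (Y i) =1 bernoulli_prob p)
    (Y_indep : mutually_independent Y) :
  let a := supnorm f in
  let b i := supnorm (f1 i) in
  let c i j := supnorm (f2 i j) in
  let logP t := lne (P [set w | t * n%:R <= f (bool_vec R (Y ^~ w))]) in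
  (forall delta eps t : R, 0 < delta -> 0 < eps ->
     let K := fine (phi p f t) / n%:R in
     (logP t <= - phi p f (t - delta)
                + (complexity_term p K delta b D eps)%:E
                + (smoothness_term p K delta b c)%:E)%E) /\
  (forall t : R,
     let eps0 := (Num.sqrt n%:R)^-1 * (4 + `|ln (p / (1 - p))|) in
     let delta0 := 2 / n%:R *
       Num.sqrt (\sum_(i < n) (a * c i i + b i ^+ 2)) in
     (- phi p f (t + delta0) - (eps0 * n%:R)%:E - (ln 2)%:E <= logP t)%E).
Proof.
move=> a b c logP.
have fC11 : C11_on_cube f f1 b c := C2_C11 f_C2.
have fa (y : 'rV[R]_n) : cube y -> `|f y| <= a.
  by move=> cy; case: f_C2 => fc _ _ _ _; exact: supnorm_ge.
have b0 := C11_b_ge0 fC11; have c0 := C11_c_ge0 fC11.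
have n0 : 0 < n%:R :> R by rewrite ltr0n.
pose pr (s : R) := \sum_(x : {ffun 'I_n -> bool} | s <= f (bool_vec R x))
  bern_vec (const_mx p) x.
have logPE s : logP s = lne (pr (s * n%:R))%:E.
  rewrite /logP; congr lne.
  exact: (probability_bool_vec p01 Y_bernoulli Y_indep
    (fun y => s * n%:R <= f y)).
have pi0 (x : {ffun 'I_n -> bool}) : 0 <= bern_vec (const_mx p) x.
  by apply: bern_vec_ge0 => i; rewrite mxE; case/andP: p01 => /ltW-> /ltW->.
have pr0 s : 0 <= pr s by exact: sumr_ge0.
split=> [delta eps t d0 e0|t]; lazy zeta.
- set K := fine (phi p f t) / n%:R.
  have td : t - delta <= t by rewrite gerBl ltW.
  have [P0|P0] := leP (pr (t * n%:R)) 0.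
    by rewrite logPE le0_lneNy ?leNye// lee_fin.
  (* A positive probability provides a feasible vertex, so [phi] is finite at [t] and [t - delta],
     and [fine] loses nothing. *)
  have [x /= fx] : exists x : {ffun 'I_n -> bool},
      t * n%:R <= f (bool_vec R x).
    apply: contrapT => /forallNP H; move: P0; rewrite /pr big1 ?ltxx// => x fx.
    by have := H x fx.
  have cx := @cube_bool_vec R n x.
  have phit : phi p f t \is a fin_num := phi_fin_num p01 cx fx.
  have phitd : phi p f (t - delta) \is a fin_num.
    apply: (phi_fin_num p01 cx); apply: le_trans fx.
    by rewrite ler_wpM2r// ltW.
  have nK : n%:R * K = fine (phi p f t) by rewrite /K mulrC divfK ?gt_eqF.
  have K0 : 0 <= K by rewrite divr_ge0 ?fine_ge0 ?phi_ge0.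
  rewrite logPE lne_EFin// -[phi p f (t - delta)]fineK//.
  rewrite -EFinN -!EFinD lee_fin.
  have le_m : fine (phi p f (t - delta)) <= n%:R * K.
    by rewrite nK fine_le// le_phi.
  (* If [K = 0] then [phi p f (t - delta)] vanishes as well, and the claim reduces to a probability
     being at most 1. *)
  have [K1|Kn0] := eqVneq K 0.
    have m0 : fine (phi p f (t - delta)) <= 0 by rewrite -(mulr0 n%:R) -K1.
    have lnP : ln (pr (t * n%:R)) <= 0.
      apply/ln_le0/(@le_trans _ _ (\sum_x bern_vec (const_mx p : 'rV_n) x)).
        rewrite [leRHS](bigID (fun x : {ffun 'I_n -> bool} =>
          t * n%:R <= f (bool_vec R x)))/=.
        by rewrite lerDl sumr_ge0.
      by rewrite sum_bern_vec.
    have T1 : 0 <= complexity_term p K delta b D eps.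
      by apply: complexity_term_ge0 => //; exact: ltW.
    have T2 : 0 <= smoothness_term p K delta b c.
      by apply: smoothness_term_ge0 => //; exact: ltW.
    lra.
  have Kp : 0 < K by rewrite lt_neqAle eq_sym Kn0.
  apply: (upper_tail_bound n_gt0 fC11 D_net p01 Kp d0 e0) => //.
  by move=> y cy fy; rewrite -lee_fin fineK// phi_le.
- set eps0 := _ * (4 + _); set delta0 := 2 / n%:R * _; rewrite logPE.
  (* Without a feasible point [phi] is [+oo] and the lower bound is [-oo]. *)
  have [[y [cy fy]]|H] := pselect (exists y : 'rV[R]_n,
      cube y /\ (t + delta0) * n%:R <= f y); last first.
    rewrite phi_infeasible ?leNye// => y cy; rewrite ltNge; apply/negP => fy.
    by apply: H; exists y.
  have delta0E : delta0 * n%:R =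
      2 * Num.sqrt (\sum_(i < n) (a * c i i + b i ^+ 2)).
    by rewrite /delta0 mulrAC divfK ?gt_eqF.
  have eps0E : eps0 * n%:R = Num.sqrt n%:R * (4 + `|ln (p / (1 - p))|).
    rewrite /eps0 mulrAC; congr (_ * _).
    by rewrite -[X in _ * X]sqr_sqrtr ?ltW// expr2 mulKf// gt_eqF// sqrtr_gt0.
  have main (z : 'rV[R]_n) : cube z -> (t + delta0) * n%:R <= f z ->
      expR (- rel_entropy_vec p z - eps0 * n%:R) <= 2 * pr (t * n%:R).
    move=> cz; rewrite mulrDl delta0E eps0E => fz.
    exact: (bernoulli_lower_bound fC11 fa p01 cz fz).
  have P0 : 0 < pr (t * n%:R).
    have := lt_le_trans (expR_gt0 _) (main y cy fy).
    by rewrite pmulr_rgt0.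
  have lower z : cube z -> (t + delta0) * n%:R <= f z ->
      - rel_entropy_vec p z - eps0 * n%:R <= ln 2 + ln (pr (t * n%:R)).
    move=> cz fz; rewrite -lnM ?posrE// -ler_expR lnK ?posrE ?mulr_gt0//.
    exact: main.
  have phif := phi_fin_num p01 cy fy.
  (* The bound holds for every feasible [z], hence for the infimum, which need not be known to be
     attained. *)
  have : ((- ln (pr (t * n%:R)) - eps0 * n%:R - ln 2)%:E
          <= phi p f (t + delta0))%E.
    apply: le_ereal_inf_tmp => _ [z [cz fz] <-]; rewrite lee_fin.
    by have := lower z cz fz; lra.
  rewrite lne_EFin// -(fineK phif) -EFinN -!EFinB !lee_fin; lra.
Qed.
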